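(* Let $w\in\mathbb{YF}_\infty^+$, $\beta\in(0,1)$ and let $\varepsilon>0$ be a real number. Then 1) $\displaystyle\lim_{n\to\infty}\sum_{v\in\overline{R}(w,\beta,n,\varepsilon)}\mu_{w,\beta}(v)=0$; 2) $\displaystyle\lim_{n\to\infty}\sum_{v\in R(w,\beta,n,\varepsilon)}\mu_{w,\beta}(v)=1$.
   Context: Words. $\mathbb{YF}$ is the set of finite words over the alphabet $\{1,2\}$, including the empty word, denoted $\varnothing$ here (to avoid confusion with the real number $\varepsilon$); $\mathbb{YF}_\infty$ is the set of left-infinite words $\ldots\alpha_2\alpha_1$ with $\alpha_i\in\{1,2\}$. For a word $x$, $|x|$ is the sum of its digits, $\#x$ its number of digits, $d(x)$ its number of digits $2$ (possibly $\infty$). $\mathbb{YF}_n=\{v\in\mathbb{YF}:|v|=n\}$. $xy$ denotes concatenation. Graph. The Young–Fibonacci graph has vertex set $\mathbb{YF}$, graded by rank $|x|$. The edges going up from $x$ (to rank $|x|+1$) lead to the words obtained from $x$ by either replacing the leftmost digit $1$ by $2$ (if there is a $1$), or inserting a digit $1$ somewhere to the left of the leftmost $1$ (anywhere if $x$ contains no $1$). $d(x,y)$ is the number of paths from $y$ down to $x$ (rank decreasing by $1$ at each step). Function $g$. For a finite or infinite word $x$ and $1\le j\le d(x)$, $g(x,j)$ equals $1$ plus the sum of the digits standing to the right of the $j$-th digit $2$ of $x$ counted from the right. For a finite or infinite word $w$, $\pi(w)=\prod_{i:\,g(w,i)>1}\frac{g(w,i)-1}{g(w,i)}$ (empty product is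 $1$), and $\mathbb{YF}_\infty^+=\{w\in\mathbb{YF}_\infty:\pi(w)>0\}$. $h(x,y)$ is the number of digits of the longest common suffix of the words $x$ and $y$. Function $f$. $f(x,y,z)$ is defined for $x\in\mathbb{YF}$, $y\in\{0,\dots,|x|\}$, $z\in\{0,\dots,\#x\}$. For $z=0$: if $x=\alpha_1\cdots\alpha_n$ and there is $m\in\{0,\dots,n\}$ with $\alpha_{m+1}+\dots+\alpha_n=y$, then $$f(x,y,0)=(-1)^{n-m}\prod_{j=m+1}^{n}\frac1{\alpha_{m+1}+\dots+\alpha_j}\;\prod_{j=1}^{m}\frac{1}{\alpha_j+\dots+\alpha_m};$$ otherwise $f(x,y,0)=0$. For $z>0$, recursively: $f(x1,0,z)=f(x1,0,0)$; $f(x1,y,z)=f(x1,y,0)+f(x,y-1,z-1)$ if $y>0$; $f(x2,y,z)=\frac{f(x11,y,z+1)}{1-y}$ if $y\neq1$, and $f(x2,1,z)=0$. For $x,v\in\mathbb{YF}$, $w\in\mathbb{YF}_\infty$, $\beta\in(0,1]$, $$d'_\beta(x,w)=\sum_{i=0}^{|x|}\beta^i f(x,i,h(x,w))\prod_{j=1}^{d(w)}\frac{g(w,j)-i}{g(w,j)},\qquad \mu_{w,\beta}(v)=d(\varnothing,v)\,d'_\beta(v,w)$$ (infinite products are limits of partial products). For $w\in\mathbb{YF}_\infty$, $\beta\in(0,1]$, $n\in\mathbb{N}_0$ and real $\varepsilon>0$: $R(w,\beta,n,\varepsilon)=\{v\in\mathbb{YF}_n:\pi(v)\in(\pi(w)(\beta-\varepsilon),\pi(w)(\beta+\varepsilon))\}$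 and $\overline{R}(w,\beta,n,\varepsilon)=\mathbb{YF}_n\setminus R(w,\beta,n,\varepsilon)$. *)

(* Defs.v *)
From HB Require Import structures.
From mathcomp Require Import all_boot all_order all_algebra finmap.
From mathcomp Require Import all_classical all_reals all_analysis.
Set Implicit Arguments.
Unset Strict Implicit.
Unset Printing Implicit Defensive.
Import Order.TTheory GRing.Theory Num.Theory.
Import numFieldNormedType.Exports.
Local Open Scope classical_set_scope.
Local Open Scope ring_scope.

(* A digit is a boolean: [false] is the digit 1 and [true] is the digit 2.   *)
Notation digit := bool (only parsing).
Notation one := false (only parsing).
Notation two := true (only parsing).
Definition dval (a : digit) : nat := if a is two then 2%N else 1%N.

(* A finite word is listed from left to right.  An infinite word, which is   *)
(* infinite to the left, is indexed from right to left: [w i] is the digit   *)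
(* alpha_{i+1} of the word ... alpha_2 alpha_1.                              *)
Notation word := (seq digit) (only parsing).
Notation iword := (nat -> digit) (only parsing).

Definition rank (x : word) : nat := (\sum_(a <- x) dval a)%N.

Definition ntwos (x : word) : nat := count_mem two x.

Definition YF (n : nat) : set word := [set v | rank v = n].

(* The word formed by the n rightmost digits of w.                           *)
Definition itail (w : iword) (n : nat) : word := rev (mkseq w n).

(* [index one x] is the number of digits to the left of the leftmost 1, and  *)
(* is the length of x if x contains no 1.                                    *)
Definition ups (x : word) : seq word :=
  let k := index one x in
  [seq take i x ++ one :: drop i x | i <- iota 0 k.+1] ++
  (if one \in x then [:: take k x ++ two :: drop k.+1 x] else [::]).

Definition down (y x : word) : bool := y \in ups x.

(* A path from y down to x is encoded by the list of its vertices, without   *)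
(* the initial vertex y.                                                     *)
Definition dpaths (x y : word) : set (seq word) :=
  [set p | path down y p /\ last y p = x].

(* [fset_set] is meaningful on finite sets only, see [finite_dpaths] below.  *)
Definition npaths (x y : word) : nat := #|` fset_set (dpaths x y)|%fset.

(* g(x, j) for 1 <= j <= d(x); the value is 0 for any other j.  The leftmost *)
(* digit of a word is its j-th digit 2 from the right iff it is a 2 and the  *)
(* word has exactly j digits 2.                                              *)
Fixpoint g (x : word) (j : nat) : nat :=
  if x is a :: v then
    if (a == two) && (ntwos x == j) then (rank v).+1 else g v j
  else 0%N.

(* j <= d(w), where d(w) may be infinite.                                    *)
Definition le_itwos (w : iword) (j : nat) : Prop :=
  exists n, (j <= ntwos (itail w n))%N.

(* The value of g at j is the same for all the truncations of w that have at *)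
(* least j digits 2.                                                         *)
Definition ig (w : iword) (j : nat) : nat :=
  g (itail w (xget 0%N [set n | (j <= ntwos (itail w n))%N])) j.

Definition hsuf (x : word) (w : iword) : nat :=
  \max_(k < (size x).+1 | suffix (itail w k) x) k.

(* The sum alpha_{m+1} + ... + alpha_j of digits of x = alpha_1 ... alpha_n. *)
Definition seg (x : word) (m j : nat) : nat := rank (drop m (take j x)).

Section RealValued.
Variable R : realType.
Implicit Types (x v : word) (w : iword).

Definition ypi x : R :=
  \prod_(1 <= i < (ntwos x).+1 | (1 < g x i)%N) (((g x i)%:R - 1) / (g x i)%:R).

Definition iprod w (F : nat -> R) : R :=
  limn (fun n => \prod_(1 <= j < n.+1 | `[< le_itwos w j >]) F j).

Definition iypi w : R :=
  iprod w (fun i => if (1 < ig w i)%N then ((ig w i)%:R - 1) / (ig w i)%:R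
                    else 1).

Definition f0 x (y : nat) : R :=
  let n := size x in
  if [pick m : 'I_n.+1 | seg x m n == y] is Some m then
    (-1) ^+ (n - m) * (\prod_(m.+1 <= j < n.+1) ((seg x m j)%:R)^-1) *
    (\prod_(1 <= j < m.+1) ((seg x j.-1 m)%:R)^-1)
  else 0.

(* The clause for f(x1, y, z); F stands for the function f(x, ., .).         *)
Definition fstep (x1 : word) (F : nat -> nat -> R) (y z : nat) : R :=
  match z, y with
  | 0%N, _ => f0 x1 y
  | _, 0%N => f0 x1 0
  | z'.+1, y'.+1 => f0 x1 y + F y' z'
  end.

(* [frev r] is f on the word whose digits, read from right to left, are r.   *)
(* The clause for f(x2, y, z) calls f(x11, y, z+1), which is computed from   *)
(* f(x, ., .) by two uses of the clause for a final digit 1; the defining    *)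
(* recursion is recovered in [f_z0], [f_one0], [f_oneS], [f_two], [f_two1].  *)
Fixpoint frev (r : word) : nat -> nat -> R :=
  match r with
  | [::] => fun y _ => f0 [::] y
  | one :: r' => fstep (rev (one :: r')) (frev r')
  | two :: r' => fun y z =>
      if z == 0%N then f0 (rev (two :: r')) y
      else if y == 1%N then 0
      else fstep (rev [:: one, one & r']) (fstep (rev (one :: r')) (frev r'))
             y z.+1 / (1 - y%:R)
  end.

Definition f x : nat -> nat -> R := frev (rev x).

Definition dprime (b : R) x w : R :=
  \sum_(0 <= i < (rank x).+1)
    b ^+ i * f x i (hsuf x w) *
    iprod w (fun j => ((ig w j)%:R - i%:R) / (ig w j)%:R).

Definition mu w (b : R) v : R := (npaths [::] v)%:R * dprime b v w.

Definition YFplus : set iword := [set w | 0 < iypi w].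

Definition Rset w (b : R) (n : nat) (e : R) : set word :=
  [set v | YF n v /\ ypi v \in `](iypi w * (b - e)), (iypi w * (b + e))[].

Definition Rbar w (b : R) (n : nat) (e : R) : set word :=
  YF n `\` Rset w b n e.

Lemma f_z0 x y : f x y 0 = f0 x y.
Proof.
rewrite /f -{2}(revK x); by case: (rev x) => [|[] r].
Qed.

Lemma f_one0 x z : f (rcons x one) 0 z.+1 = f (rcons x one) 0 0.
Proof. by rewrite f_z0 /f rev_rcons /= rev_cons revK. Qed.

Lemma f_oneS x y z :
  f (rcons x one) y.+1 z.+1 = f (rcons x one) y.+1 0 + f x y z.
Proof. by rewrite f_z0 /f rev_rcons /= rev_cons revK. Qed.

Lemma f_two x y z : y != 1%N ->
  f (rcons x two) y z.+1 = f (rcons (rcons x one) one) y z.+2 / (1 - y%:R).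
Proof. by move=> y1; rewrite /f !rev_rcons /= (negbTE y1). Qed.

Lemma f_two1 x z : f (rcons x two) 1 z.+1 = 0.
Proof. by rewrite /f rev_rcons. Qed.

End RealValued.

Lemma rank_cons a x : rank (a :: x) = (dval a + rank x)%N.
Proof. by rewrite /rank big_cons. Qed.

Lemma rank_cat x y : rank (x ++ y) = (rank x + rank y)%N.
Proof. by rewrite /rank big_cat. Qed.

Lemma finite_YF n : finite_set (YF n).
Proof.
elim/ltn_ind: n => -[|n] IH.
  apply: (@sub_finite_set _ _ [set [::]]); last exact: finite_set1.
  by move=> [|[] x] //; rewrite /YF /= rank_cons.
pose A := cons one @` YF n `|` cons two @` YF n.-1.
apply: (@sub_finite_set _ _ A).
  move=> [|[] x]; rewrite /YF /=; first by rewrite /rank big_nil.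
    by rewrite rank_cons /= => -[xn]; right; exists x => //=; rewrite -xn.
  by rewrite rank_cons /= => -[xn]; left; exists x.
rewrite finite_setU; split; apply: finite_image; apply: IH => //.
by rewrite ltnS leq_pred.
Qed.

Lemma rank_down y x : down y x -> rank y = (rank x).+1.
Proof.
rewrite /down /ups mem_cat => /orP[/mapP[i _ ->]|].
  by rewrite rank_cat rank_cons addnCA -rank_cat cat_take_drop.
case: ifP => // x1; rewrite inE => /eqP ->.
have -> : rank x = (rank (take (index one x) x) +
    (1 + rank (drop (index one x).+1 x)))%N.
  rewrite -{1}(cat_take_drop (index one x) x) (drop_nth one) ?index_mem//.
  by rewrite (nth_index one x1) rank_cat rank_cons.
by rewrite rank_cat rank_cons -addnS.
Qed.

Lemma finite_dpaths x y : finite_set (dpaths x y).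
Proof.
apply: (@sub_finite_set _ _ [set p | path down y p]); first by move=> p [].
move: {2}(rank y) (erefl (rank y)) => n; elim: n y => [|n IH] y yn.
  apply: (@sub_finite_set _ _ [set [::]]); last exact: finite_set1.
  by move=> [|z p] //= /andP[/rank_down]; rewrite yn.
pose A := [set [::]] `|` \bigcup_(z in YF n) (cons z @` [set p | path down z p]).
apply: (@sub_finite_set _ _ A).
  move=> [|z p] /=; first by left.
  move=> /andP[/rank_down]; rewrite yn => -[zn] zp.
  by right; exists z => //; exists p.
rewrite finite_setU; split; first exact: finite_set1.
apply: bigcup_finite; first exact: finite_YF.
by move=> z zn; apply: finite_image; apply: IH.
Qed.

(* Main.v *)
Require Import Defs.
From HB Require Import structures.
From mathcomp Require Import all_boot all_order all_algebra finmap.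
From mathcomp Require Import all_classical all_reals all_analysis.
From mathcomp Require Import ring lra zify.
Set Implicit Arguments.
Unset Strict Implicit.
Unset Printing Implicit Defensive.
Import Order.TTheory GRing.Theory Num.Theory.
Import numFieldNormedType.Exports.
Local Open Scope classical_set_scope.
Local Open Scope ring_scope.

(** For a finite word v, choose uniformly a path from v down to the empty word, and
    let p_v(x) be the probability that it goes through x ([passage]).  The number
    of paths between two words is an explicit combination of the products of the
    g(v, j) - i over the digits 2 of v ([npaths_formula]).  Hence p_v(x) tends to
    mu_{w,b}(x) when v runs through finite words V k which have longer and longer
    common suffixes with w and for which pi(V k) tends to b pi(w)
    ([approximants], [cvg_passage]).  In particular mu_{w,b} is a probability on each
    level, and the theorem says that pi hardly changes, in probability, along a
    random path from V k down to rank n, provided that n is large.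

    To see this, fix a suffix s of w and let Q_i(x) be the product of (g - i) / g over
    the digits 2 of x to the left of s, or 0 if s is not a suffix of x ([ratpi]); thus
    Q_1(x) = pi(x) / pi(s) when s is a suffix of x.  For i >= 3 the function Q_i is
    nearly harmonic: its mean over the words of rank n on a random path from v differs
    from Q_i(v) by O(1 / n), uniformly in v ([passage_ratpi]).  The reason is that the
    product of the g - i, summed over the lower neighbours of a word, reproduces
    itself, except on the words 2...2u with rank u at most rank s + 1, and
    there the error is O(1 / rank^2) relative to the number of paths to the empty
    word ([defect_bound]).

    Since all g involved exceed rank s, Q_i is Q_1^i up to O(1 / rank s)
    ([ratpi_pow]).  So the means of Q_3 and of Q_6, that is nearly of Q_3^2, are close
    to Q_1(v)^3 and Q_1(v)^6: the variance of Q_3 is small ([passage_variance]), and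
    with probability close to 1 the value Q_3(x) is close to Q_1(v)^3, hence to b^3.
    This forces s to be a suffix of x and pi(x) to be close to b pi(w)
    ([far_from_band]). *)

(** * Lower neighbours, paths and words of a given rank *)

(** The lower neighbours of a word.  The word 1v covers v only, and the lower
    neighbours of 2v are the upper neighbours of v, which are 1v and the words 2u
    with u a lower neighbour of v. *)
Fixpoint downs (v : seq bool) : seq (seq bool) :=
  match v with
  | [::] => [::]
  | false :: v' => [:: v']
  | true :: v' => (false :: v') :: map (cons true) (downs v')
  end.

Lemma ups_nil : ups [::] = [:: [:: false]].
Proof. by []. Qed.

Lemma ups_one x : ups (false :: x) = [:: [:: false, false & x]; true :: x].
Proof. by rewrite /ups /= drop0. Qed.

Lemma ups_two x : ups (true :: x) = (false :: true :: x) :: map (cons true) (ups x).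
Proof.
rewrite /ups.
have -> : index false (true :: x) = (index false x).+1 by [].
move: (index false x) => k.
rewrite -[iota 0 k.+2]/(0%N :: iota (1 + 0) k.+1) iotaDl map_cons cat_cons.
congr (_ :: _).
rewrite map_cat -!map_comp; congr (_ ++ _); last by case: ifP; rewrite inE /= => ->.
Qed.

Lemma cons_inj (T : eqType) (a : T) : injective (cons a).
Proof. by move=> x y []. Qed.

Lemma mem_map_cons (T : eqType) (a b : T) x (s : seq (seq T)) :
  (a :: x \in map (cons b) s) = (a == b) && (x \in s).
Proof.
apply/mapP/andP => [[y ys [-> ->]]|[/eqP -> xs]]; first by rewrite eqxx.
by exists x.
Qed.

Lemma nil_map_cons (T : eqType) (b : T) (s : seq (seq T)) :
  ([::] \in map (cons b) s) = false.
Proof. by apply/negbTE/mapP => -[]. Qed.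

Lemma down_downs y x : Defs.down y x = (x \in downs y).
Proof.
rewrite /Defs.down; elim: y x => [|a y IH] [|c x].
- by [].
- by case: c; rewrite ?ups_one ?ups_two ?inE /= ?nil_map_cons.
- by case: a; rewrite ups_nil /= !inE ?nil_map_cons // eqseq_cons /= eq_sym.
case: a; rewrite [downs _]/= ; case: c; rewrite ?ups_one ?ups_two in_cons.
- by rewrite [in RHS]in_cons !mem_map_cons IH !eqseq_cons.
- by rewrite !inE mem_map_cons !eqseq_cons /= orbF eq_sym.
- by rewrite mem_map_cons [in RHS]inE !eqseq_cons /= orbF eq_sym.
- by rewrite !inE !eqseq_cons /= orbF eq_sym.
Qed.

Lemma uniq_downs v : uniq (downs v).
Proof.
elim: v => [|[] v IH] //=; rewrite map_inj_uniq ?IH ?andbT; last exact: cons_inj.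
by rewrite mem_map_cons.
Qed.

Lemma rank_nil : rank [::] = 0%N.
Proof. by rewrite /rank big_nil. Qed.

Lemma rank_downs v u : u \in downs v -> rank v = (rank u).+1.
Proof. by rewrite -down_downs => /rank_down. Qed.

(** An enumeration of [dpaths x y] when rank y = rank x + m, see [npathsE]. *)
Fixpoint path_list (m : nat) (x y : seq bool) : seq (seq (seq bool)) :=
  if m is m'.+1 then
    flatten [seq [seq u :: p | p <- path_list m' x u] | u <- downs y]
  else if y == x then [:: [::]] else [::].

Lemma rank_path y p : path Defs.down y p -> rank y = (rank (last y p) + size p)%N.
Proof.
elim: p y => [|u p IH] y /=; first by rewrite addn0.
by move=> /andP[/rank_down -> /IH ->]; rewrite addnS.
Qed.

Lemma mem_path_list m x y p :
  (p \in path_list m x y) = [&& path Defs.down y p, last y p == x & size p == m].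
Proof.
elim: m y p => [|m IH] y p /=.
  by case: p => [|u p]; case: eqVneq => //= _; rewrite ?andbF// !inE.
apply/flattenP/idP => [[_ /mapP[u uy ->] /mapP[q qu ->]]|].
  by move: qu; rewrite IH /= down_downs uy /= eqSS.
case: p => [|u p] /=; first by rewrite andbF.
rewrite eqSS => /and3P[/andP[yu up] lx sm].
exists [seq u :: p | p <- path_list m x u].
  by apply/mapP; exists u => //; rewrite -down_downs.
by rewrite map_f// IH up lx sm.
Qed.

Lemma uniq_path_list m x y : uniq (path_list m x y).
Proof.
elim: m y => [|m IH] y /=; first by case: eqP.
elim: (downs y) (uniq_downs y) => [|u s IHs] //= /andP[us /IHs {}IHs].
rewrite cat_uniq IHs andbT map_inj_uniq ?IH /=; last exact: cons_inj.
apply/hasPn => p /flattenP[_ /mapP[t ts ->] /mapP[q _ ->]].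
apply/mapP => -[q' _ [tu _]]; by rewrite -tu ts in us.
Qed.

Lemma npathsE x y m : rank y = (rank x + m)%N -> npaths x y = size (path_list m x y).
Proof.
move=> ryx; rewrite /npaths.
rewrite -(undup_id (uniq_path_list m x y)) -card_fseq; congr (#|` _|%fset).
apply/fsetP => p; rewrite in_fset_set ?inE; last exact: finite_dpaths.
rewrite mem_path_list; apply/idP/and3P => [|[yp /eqP lx _]].
  rewrite inE /= => -[yp lx]; split=> //; first exact/eqP.
  by move/rank_path: yp; rewrite lx ryx => /addnI ->.
by rewrite inE.
Qed.

Lemma npaths_eq x y : rank x = rank y -> npaths x y = (y == x).
Proof. by move=> rxy; rewrite (@npathsE _ _ 0%N) ?addn0//=; case: eqP. Qed.

(** A path of positive length is determined by its first step and by the rest. *)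
Lemma npaths_rec x y : (rank x < rank y)%N ->
  npaths x y = (\sum_(u <- downs y) npaths x u)%N.
Proof.
move=> xy; rewrite (@npathsE _ _ (rank y - rank x)); last lia.
rewrite -[(_ - _)%N](@prednK) ?subn_gt0//= size_flatten /shape -map_comp.
rewrite sumnE big_map big_seq [RHS]big_seq; apply: eq_bigr => u /rank_downs yu.
by rewrite /= size_map; apply/esym/npathsE; rewrite yu in xy *; lia.
Qed.

(** The words of rank n, without repetition, for sums over a level of the graph. *)
Fixpoint words (n : nat) : seq (seq bool) :=
  match n with
  | 0 => [:: [::]]
  | n1.+1 => if n1 is n2.+1 then map (cons false) (words n1) ++
                                 map (cons true) (words n2)
             else [:: [:: false]]
  end.

Lemma wordsSS n :
  words n.+2 = map (cons false) (words n.+1) ++ map (cons true) (words n).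
Proof. by []. Qed.

Lemma rank_eq0 v : (rank v == 0%N) = (v == [::]).
Proof. by case: v => [|[] v]; rewrite ?rank_nil ?rank_cons. Qed.

Lemma mem_words n v : (v \in words n) = (rank v == n).
Proof.
elim/ltn_ind: n v => -[|[|n]] IH v; first by rewrite inE rank_eq0.
  rewrite inE; case: v => [|[] v]; rewrite ?rank_nil ?rank_cons ?eqseq_cons//=.
  by rewrite -rank_eq0.
rewrite wordsSS mem_cat.
case: v => [|a v]; first by rewrite !nil_map_cons rank_nil.
rewrite !mem_map_cons !IH//; case: a; rewrite rank_cons /= ?orbF; lia.
Qed.

Lemma uniq_words n : uniq (words n).
Proof.
elim/ltn_ind: n => -[|[|n]] IH //.
rewrite wordsSS cat_uniq !map_inj_uniq ?IH//; try exact: cons_inj.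
rewrite andbT /=; apply/hasPn => v /mapP[u _ ->].
by rewrite mem_map_cons.
Qed.

Lemma sum_YF (R : realType) n (A : set (seq bool)) (F : seq bool -> R) :
  A `<=` YF n ->
  \sum_(v \in A) F v = \sum_(v <- words n | v \in A) F v.
Proof.
move=> An; rewrite (@fsbigE _ _ _ _ A [seq v <- words n | v \in A]).
- by rewrite big_filter_cond; apply: eq_bigl => v; rewrite andbb.
- exact/filter_uniq/uniq_words.
- by move=> v /=; rewrite mem_filter => /andP[]; rewrite inE.
- move=> v Av; rewrite mem_filter negb_and mem_words => /orP[/negP|/eqP].
    by rewrite inE.
  by move/(_ (An _ Av)).
Qed.

Lemma npaths_one x v : (rank x <= rank v)%N ->
  npaths x (false :: v) = npaths x v.
Proof. by move=> xv; rewrite npaths_rec ?rank_cons//= big_seq1. Qed.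

(** The first step from 2v leads to 1v or to 2u with u a lower neighbour of v.  By
    induction the second case is expressed by the numbers of paths from u, which add
    up to those from v.  This is the commutation relation DU - UD = 1 of the graph,
    read on the leftmost digits.  The rank condition keeps the truncated subtraction
    exact. *)
Lemma npaths_two a x v : (rank (a :: x) <= (rank v).+1)%N ->
  npaths (a :: x) (true :: v) =
  (((rank v).+1 - rank (a :: x)) * npaths (a :: x) v + npaths x v)%N.
Proof.
have [n] := ubnP (rank v); elim: n v => // n IH v; rewrite ltnS => vn axv.
have x_lt : (rank x < rank (a :: x))%N by rewrite rank_cons; case: (a).
rewrite npaths_rec; last by rewrite [rank (true :: v)]rank_cons /=; lia.
rewrite /= big_cons big_map.
have [axv1|] := eqVneq (rank (a :: x)) (rank v).+1.
  rewrite axv1 subnn mul0n add0n npaths_eq; last by rewrite axv1 rank_cons.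
  under eq_big_seq => u /rank_downs vu.
    rewrite npaths_eq; last by rewrite axv1 rank_cons vu.
    rewrite eqseq_cons; over.
  rewrite eqseq_cons; case: a {x_lt axv IH} axv1; rewrite rank_cons => -[/= rx].
    rewrite npaths_rec; last by rewrite -rx.
    by apply: eq_big_seq => u /rank_downs vu; rewrite npaths_eq//; lia.
  by rewrite big1// addn0 npaths_eq//; lia.
move=> axv'; have {axv'} axv' : (rank (a :: x) <= rank v)%N by lia.
rewrite npaths_one//.
under eq_big_seq => u /rank_downs vu.
  rewrite IH; [|lia|lia]; rewrite -vu; over.
rewrite big_split /= -big_distrr /= -(npaths_rec (x := x)); last lia.
move: axv'; rewrite leq_eqVlt => /orP[/eqP ->|axv'].
  by rewrite subnn mul0n add0n subSnn mul1n.
by rewrite -npaths_rec// addnA -mulSn subSn// ltnW.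
Qed.

(** * Longest common suffix *)

Fixpoint lcp (r t : seq bool) : nat :=
  match r, t with
  | a :: r', b :: t' => if a == b then (lcp r' t').+1 else 0%N
  | _, _ => 0%N
  end.

(** The analogue of [hsuf] for two finite words, which are reversed so that [lcp]
    meets their last digits first. *)
Definition csuf x v := lcp (rev x) (rev v).

Lemma csuf_rcons x v a b :
  csuf (rcons x a) (rcons v b) = if a == b then (csuf x v).+1 else 0%N.
Proof. by rewrite /csuf !rev_rcons. Qed.

Lemma rank_rcons x a : rank (rcons x a) = (rank x + dval a)%N.
Proof. by rewrite -cats1 rank_cat rank_cons rank_nil addn0. Qed.

Lemma rank_rev x : rank (rev x) = rank x.
Proof. by elim: x => // a x IH; rewrite rev_cons rank_rcons IH rank_cons addnC. Qed.

(** A digit added on the left of v can only extend the common suffix when all of the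
    longer word is a suffix of x, which the ranks exclude. *)
Lemma csuf_consr x b v : (rank x < rank (b :: v))%N -> csuf x (b :: v) = csuf x v.
Proof.
rewrite /csuf -(rank_rev x) -(rank_rev (b :: v)) rev_cons.
move: (rev x) (rev v) => {x v}; elim=> [|a r IH] [|c t] //=.
  by case: eqP => // ->; rewrite !rank_cons rank_nil; lia.
by case: eqP => // ->; rewrite !rank_cons ltn_add2l => /IH ->.
Qed.

Lemma csuf_consl x a v : csuf x v = minn (csuf (a :: x) v) (size x).
Proof.
rewrite /csuf -(size_rev x) rev_cons.
move: (rev x) (rev v) => {x v}; elim=> [|c r IH] [|b t] //=; rewrite ?minn0 ?min0n//.
by case: eqP => //; rewrite IH minnSS.
Qed.

Lemma rank_size x : rank x = (size x + ntwos x)%N.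
Proof.
by rewrite /ntwos; elim: x => [|[] x IH]; rewrite ?rank_nil ?rank_cons /= ?IH ?addnS ?add0n ?add1n ?add2n ?addSn ?addnS.
Qed.

(** * Products over the digits 2 and the coefficients f *)

Section Coefficients.
Variable R : realType.
Implicit Types (x v : seq bool).

(** The product of F (g(v, j)) over the digits 2 of v, see [tprodE]: for the digit 2
    at the left of v', the value of g is rank v' + 1. *)
Fixpoint tprod (F : nat -> R) v : R :=
  match v with
  | [::] => 1
  | false :: v' => tprod F v'
  | true :: v' => F (rank v').+1 * tprod F v'
  end.

(** The number of paths from v down to the empty word, see [npaths_nil]. *)
Definition dimw v := tprod (fun m => m%:R) v.
Definition pol (z : R) v := tprod (fun m => m%:R - z) v.

Lemma eq_tprod F G v : F =1 G -> tprod F v = tprod G v.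
Proof. by move=> FG; elim: v => [|[] v IH] //=; rewrite FG IH. Qed.

Lemma tprod_rcons F v a : tprod F (rcons v a) =
  (if a then F 1%N else 1) * tprod (fun m => F (m + dval a)%N) v.
Proof.
elim: v => [|[] v IH] //=; first by case: a; rewrite /= ?rank_nil ?mulr1.
by rewrite IH mulrCA rank_rcons addSn.
Qed.

Lemma dimw_gt0 v : 0 < dimw v.
Proof. by rewrite /dimw; elim: v => [|[] v IH] //=; rewrite mulr_gt0. Qed.

Lemma dimw_ge1 v : 1 <= dimw v.
Proof.
rewrite /dimw; elim: v => [|[] v IH] //=.
by rewrite mulr_ege1// ler1n.
Qed.

Lemma dimw_downs v : v != [::] -> \sum_(u <- downs v) dimw u = dimw v.
Proof.
elim: v => [|[] v IH] //= _; last by rewrite big_seq1.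
rewrite big_cons big_map [in RHS]/dimw /= -/(dimw v).
under eq_big_seq => u /rank_downs vu do rewrite /dimw /= -/(dimw u) -vu.
rewrite -mulr_sumr -[X in X + _]mul1r.
have [->|v0] := eqVneq v [::]; first by rewrite rank_nil /= mul0r addr0.
by rewrite IH// -mulrDl -natr1 addrC.
Qed.

Lemma npaths_nil v : (npaths [::] v)%:R = dimw v.
Proof.
have [n] := ubnP (rank v); elim: n v => // n IH v; rewrite ltnS => vn.
have [->|v0] := eqVneq v [::]; first by rewrite npaths_eq.
rewrite npaths_rec; last by rewrite rank_nil lt0n rank_eq0.
rewrite -dimw_downs// natr_sum; apply: eq_big_seq => u /rank_downs vu.
by apply: IH; lia.
Qed.

Lemma seg_size x m : seg x m (size x) = rank (drop m x).
Proof. by rewrite /seg take_size. Qed.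

Lemma rank_drop_inj x m m' : (m <= size x)%N -> (m' <= size x)%N ->
  rank (drop m x) = rank (drop m' x) -> m = m'.
Proof.
wlog lt_mm : m m' / (m < m')%N => [hw mx m'x e|mx m'x].
  by case: (ltngtP m m') => // h; [|apply/esym]; apply: hw.
have -> : drop m x = take (m' - m) (drop m x) ++ drop m' x.
  by rewrite -{1}(cat_take_drop (m' - m) (drop m x)) drop_drop subnK// ltnW.
rewrite rank_cat => /eqP; rewrite -[X in _ == X]add0n eqn_add2r rank_eq0.
by move/eqP/(congr1 size); rewrite size_takel ?size_drop /=; lia.
Qed.

(** The value of f(x, y, 0) when y is the sum of the digits of x after the m-th. *)
Definition f0val x m : R :=
  (-1) ^+ (size x - m) * (\prod_(m.+1 <= j < (size x).+1) ((seg x m j)%:R)^-1) *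
    (\prod_(1 <= j < m.+1) ((seg x j.-1 m)%:R)^-1).

Lemma f0_drop x m : (m <= size x)%N -> f0 R x (rank (drop m x)) = f0val x m.
Proof.
move=> mx; rewrite /f0; case: pickP => [k /eqP|/(_ (Ordinal (mx : (m < _.+1)%N)))].
  rewrite seg_size => /rank_drop_inj ->//; by rewrite -ltnS.
by rewrite seg_size eqxx.
Qed.

Lemma f0_none x y : (forall m, (m <= size x)%N -> rank (drop m x) <> y) ->
  f0 R x y = 0.
Proof.
move=> h; rewrite /f0; case: pickP => [k /eqP|//].
by rewrite seg_size => /h; case; rewrite -ltnS.
Qed.

Lemma f0_case x y : (exists2 m, (m <= size x)%N & rank (drop m x) = y) \/
  (forall m, (m <= size x)%N -> rank (drop m x) <> y).
Proof.
have [/existsP[m /eqP]|/existsPn h] :=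
    boolP [exists m : 'I_(size x).+1, rank (drop m x) == y].
  by left; exists m => //; rewrite -ltnS.
by right => m mx; apply/eqP; exact: h (Ordinal (mx : (m < _.+1)%N)).
Qed.

Lemma f0_nil y : f0 R [::] y = (y == 0%N)%:R.
Proof.
case: y => [|y]; last by apply: f0_none => m /= _; rewrite rank_nil.
have := @f0_drop [::] 0 isT; rewrite rank_nil => ->.
by rewrite /f0val /= !big_geq// !mulr1.
Qed.

(** If y is a suffix sum of x, then the leftmost digit a only contributes the factor
    1 / (rank (ax) - y).  If y = rank (ax), then the coefficient on the left vanishes. *)
Lemma f0_cons a x y : ((rank (a :: x))%:R - y%:R) * f0 R (a :: x) y = f0 R x y.
Proof.
have [[m mx <-]|h] := f0_case x y.
  rewrite f0_drop// -[drop m x]/(drop m.+1 (a :: x)) f0_drop//.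
  rewrite /f0val [size (a :: x)]/= subSS big_add1 [in X in _ * X]big_nat_recl//.
  rewrite (_ : seg (a :: x) 1.-1 m.+1 = rank (a :: x) - rank (drop m x))%N; last first.
    rewrite /seg drop0 -{2}(cat_take_drop m.+1 (a :: x)) rank_cat /= addnK.
    by [].
  rewrite natrB; last first.
    by rewrite rank_cons -{2}(cat_take_drop m x) rank_cat; lia.
  rewrite (eq_big_nat _ _ (F2 := fun i => ((seg x m i)%:R)^-1))//.
  rewrite [X in _ * (_ * (_ * X)) = _](eq_big_nat _ _ (F2 := fun i => ((seg x i.-1 m)%:R)^-1)); last first.
    by case.
  set d := _ - _; have d0 : d != 0.
    rewrite /d subr_eq0 eqr_nat rank_cons -{1}(cat_take_drop m x) rank_cat.
    by case: (a); apply/eqP => /=; lia.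
  by field.
rewrite (f0_none h).
have [->|y0] := eqVneq y (rank (a :: x)); first by rewrite subrr mul0r.
rewrite f0_none ?mulr0// => -[_|m mx]; last exact: h.
by rewrite drop0 => e; rewrite e eqxx in y0.
Qed.

(** The last digit contributes a factor 1 / y and a change of sign. *)
Lemma f0_rcons a x y : y%:R * f0 R (rcons x a) y =
  if (y < dval a)%N then 0 else - f0 R x (y - dval a).
Proof.
have drop_r m : (m <= size x)%N -> drop m (rcons x a) = rcons (drop m x) a.
  by move=> mx; rewrite -!cats1 drop_cat; case: ltngtP mx => // ->;
     rewrite subnn drop0 drop_size.
have [[m mx ey]|h] := f0_case (rcons x a) y; last first.
  rewrite f0_none// mulr0; case: ltnP => // ay; rewrite f0_none ?oppr0//.
  move=> m mx e; apply: (h m); first by rewrite size_rcons; lia.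
  by rewrite drop_r// rank_rcons e subnK.
move: mx; rewrite size_rcons leq_eqVlt => /orP[/eqP mx|]; last rewrite ltnS => mx.
  move: ey; rewrite mx -(size_rcons x a) drop_size rank_nil => <-.
  by rewrite mul0r; case: a {drop_r}.
rewrite -ey drop_r// rank_rcons ltnNge leq_addl /= addnK f0_drop//.
rewrite -rank_rcons -drop_r// f0_drop; last by rewrite size_rcons; lia.
rewrite /f0val size_rcons (subSn mx) exprS big_nat_recr//=.
have -> : seg (rcons x a) m (size x).+1 = rank (drop m (rcons x a)).
  by rewrite -(size_rcons x a) seg_size.
rewrite (eq_big_nat _ _ (F2 := fun j => ((seg x m j)%:R)^-1)); last first.
  by move=> j /andP[_ js]; rewrite /seg -cats1 takel_cat// -ltnS.
rewrite [X in _ * (_ * X) = _](eq_big_nat _ _ (F2 := fun j => ((seg x j.-1 m)%:R)^-1)); last first.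
  by move=> j _; rewrite /seg -cats1 takel_cat.
set d := (rank _)%:R; have d0 : d != 0.
  rewrite /d drop_r// rank_rcons pnatr_eq0; by case: a {ey drop_r d}; rewrite addnC.
by field.
Qed.

Lemma f0_gt x y : (rank x < y)%N -> f0 R x y = 0.
Proof.
move=> xy; apply: f0_none => m mx e.
by move: xy; rewrite -e -{1}(cat_take_drop m x) rank_cat; lia.
Qed.

Lemma f_rcons1 x y z : f R (rcons x false) y z.+1 =
  f0 R (rcons x false) y + (if y is y'.+1 then f R x y' z else 0).
Proof. by case: y => [|y]; rewrite ?f_one0 ?f_oneS f_z0 ?addr0. Qed.

Lemma f_rcons2 x y z : y != 1%N -> f R (rcons x true) y z.+1 =
  (f0 R (rcons (rcons x false) false) y +
   (if y is y'.+1 then f0 R (rcons x false) y' +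
     (if y' is y''.+1 then f R x y'' z else 0) else 0)) / (1 - y%:R).
Proof. by move=> y1; rewrite f_two// f_rcons1; case: y y1 => // y _; rewrite f_rcons1. Qed.

Lemma f_nil y z : f R [::] y z = (y == 0%N)%:R.
Proof. by rewrite /f /= f0_nil. Qed.

Lemma f_minn x y z : f R x y z = f R x y (minn z (size x)).
Proof.
elim/last_ind: x y z => [|x a IH] y [|z]; rewrite ?min0n// ?f_nil//.
rewrite size_rcons minnSS; case: a.
  have [->|y1] := eqVneq y 1%N; first by rewrite !f_two1.
  by rewrite !f_rcons2//; case: y {y1} => [|[|y]] //; rewrite IH.
by rewrite !f_rcons1; case: y => // y; rewrite IH.
Qed.

Lemma subr1n_neq0 y : y != 1%N -> 1 - y%:R != 0 :> R.
Proof. by move=> y1; rewrite subr_eq0 eq_sym -[1]/(1%:R) eqr_nat. Qed.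

(** The two clauses of the recursion defining f act on the right end of the word and
    commute with the factor that a leftmost digit contributes to f0.  This is what
    matches f with the numbers of paths, whose recursion [npaths_two] acts on the
    left end. *)
Lemma f_cons a x y z : ((rank (a :: x))%:R - y%:R) * f R (a :: x) y z = f R x y z.
Proof.
case: z => [|z]; first by rewrite !f_z0 f0_cons.
elim/last_ind: x y z => [|x c IH] y z.
  have e1 y' : (1 - y'%:R) * f0 R [:: false] y' = f0 R [::] y'.
    by have := f0_cons false [::] y'; rewrite rank_cons rank_nil.
  have e2 y' : (2 - y'%:R) * f0 R [:: false; false] y' = f0 R [:: false] y'.
    by have := f0_cons false [:: false] y'; rewrite !rank_cons rank_nil.
  rewrite rank_cons rank_nil addn0 f_nil -[[:: a]]/(rcons [::] a).
  case: a; rewrite [dval _]/=.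
    have [->|y1] := eqVneq y 1%N; first by rewrite f_two1 mulr0.
    have := subr1n_neq0 y1.
    rewrite f_rcons2//=; case: y y1 => [|[|[|y]]] //= _ y1; rewrite ?f_nil ?addr0.
    - by have := e1 0%N; have := e2 0%N; rewrite !subr0 divr1 mul1r f0_nil => -> ->.
    - by rewrite subrr mul0r.
    - have -> : f0 R [:: false; false] y.+3 = 0 by rewrite f0_gt// !rank_cons rank_nil.
      have -> : f0 R [:: false] y.+2 = 0 by rewrite f0_gt// !rank_cons rank_nil.
      by rewrite !addr0 mul0r mulr0.
  rewrite f_rcons1 mulrDr e1 f0_nil.
  by case: y => [|[|y]]; rewrite ?mulr0 ?addr0// f_nil ?subrr ?mul0r ?addr0//= mulr0 addr0.
have e1 y' : ((rank (a :: x))%:R + 1 - y'%:R) * f0 R (rcons (a :: x) false) y' =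
    f0 R (rcons x false) y'.
  by have := f0_cons a (rcons x false) y'; rewrite -rcons_cons rank_rcons natrD.
have e2 y' : ((rank (a :: x))%:R + 2 - y'%:R) *
    f0 R (rcons (rcons (a :: x) false) false) y' = f0 R (rcons (rcons x false) false) y'.
  have := f0_cons a (rcons (rcons x false) false) y'.
  by rewrite -!rcons_cons !rank_rcons -addnA natrD.
have {}IH y' : ((rank (a :: x))%:R - y'%:R) * f R (a :: x) y' z = f R x y' z.
  by case: z IH => [|z] IH; rewrite ?f_z0 ?f0_cons.
rewrite -rcons_cons rank_rcons natrD; case: c; rewrite [dval _]/=.
  (* for y = 1 both sides vanish by the convention for a final digit 2 *)
  have [->|y1] := eqVneq y 1%N; first by rewrite !f_two1 mulr0.
  rewrite !f_rcons2// -e2 mulrA; congr (_ / _).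
  case: y y1 => [|[|y]] // _; first by rewrite !addr0.
  by rewrite -e1 -IH -!natr1; ring.
rewrite !f_rcons1 -e1; case: y => [|y]; first by rewrite !addr0.
by rewrite -IH -natr1; ring.
Qed.

Lemma f_gt x y z : (rank x < y)%N -> f R x y z = 0.
Proof.
elim: x => [|a x IH]; first by rewrite f_nil rank_nil; case: y.
move=> axy; have /eqP := f_cons a x y z.
rewrite IH; last by move: axy; rewrite rank_cons; lia.
by rewrite mulf_eq0 subr_eq0 eqr_nat => /orP[/eqP e|/eqP//]; lia.
Qed.
End Coefficients.

(** * The number of paths between two words *)

Section NumberOfPaths.
Variable R : realType.
Implicit Types (x v : seq bool).

Lemma sum_f_widen x z (G : nat -> R) B : (rank x < B)%N ->
  \sum_(0 <= i < B) f R x i z * G i =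
  \sum_(0 <= i < (rank x).+1) f R x i z * G i.
Proof.
move=> xB; rewrite (@big_cat_nat _ _ _ (rank x).+1) //=.
rewrite [X in _ + X = _](_ : _ = 0) ?addr0// big_nat big1// => i /andP[xi _].
by rewrite f_gt// mul0r.
Qed.

Lemma sum_f_cons a x z (G : nat -> R) :
  \sum_(0 <= i < (rank (a :: x)).+1)
     ((rank (a :: x))%:R - i%:R) * f R (a :: x) i z * G i =
  \sum_(0 <= i < (rank x).+1) f R x i z * G i.
Proof.
under eq_bigr do rewrite f_cons.
by apply: sum_f_widen; rewrite rank_cons; lia.
Qed.

Lemma pol0 (v : seq bool) : pol (0 : R) v = dimw R v.
Proof. by apply: eq_tprod => m; rewrite subr0. Qed.

Lemma pol_rcons1 i v : pol (i.+1%:R : R) (rcons v false) = pol i%:R v.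
Proof.
rewrite /pol tprod_rcons mul1r; apply: eq_tprod => m.
by rewrite /= addn1 -!natr1; ring.
Qed.

Lemma pol_rcons2 i v :
  pol (i.+2%:R : R) (rcons v true) = (1 - i.+2%:R) * pol i%:R v.
Proof.
rewrite /pol tprod_rcons; congr (_ * _); apply: eq_tprod => m.
by rewrite /= addn2 -!natr1; ring.
Qed.

(** The numbers f0(x, y) are the coefficients of a divided difference, up to sign,
    whose nodes are the suffix sums of x; it kills the constants as soon as there are
    two nodes.  Subtracting [f0_rcons] from [f0_cons] yields an induction on the
    number of digits. *)
Lemma sum_f0 x : x != [::] ->
  \sum_(0 <= i < (rank x).+1) f R x i 0 = 0.
Proof.
suff H n y : (size y <= n)%N ->
    \sum_(0 <= i < (rank y).+1) f R y i 0 = (y == [::])%:R.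
  by move=> x0; rewrite (H (size x))// (negbTE x0).
elim: n y => [|n IH] y; first by case: y => // _; rewrite rank_nil big_nat1 f_nil.
case: (y =P [::]) => [-> _|/eqP y0 yn]; first by rewrite rank_nil big_nat1 f_nil.
apply: (mulfI (_ : (rank y)%:R != 0)); first by rewrite pnatr_eq0 rank_eq0.
rewrite mulr0 mulr_sumr.
have -> : \sum_(0 <= i < (rank y).+1) (rank y)%:R * f R y i 0 =
    \sum_(0 <= i < (rank y).+1) ((rank y)%:R - i%:R) * f R y i 0 * 1 +
    \sum_(0 <= i < (rank y).+1) i%:R * f0 R y i.
  by rewrite -big_split /=; apply: eq_bigr => i _; rewrite f_z0; ring.
case: y y0 yn => // a y _ yn.
rewrite sum_f_cons; under eq_bigr do rewrite mulr1.
rewrite IH//; rewrite lastI.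
set y' := belast a y; set b := last a y.
under eq_bigr do rewrite f0_rcons.
rewrite rank_rcons (@big_cat_nat _ _ _ (dval b))//=; last by lia.
rewrite [X in _ + (X + _) = _](_ : _ = 0) ?add0r; last first.
  by rewrite big_nat big1// => i /andP[_ ->].
rewrite -{1}[dval b]add0n big_addn -addSn addnK.
under eq_bigr => i _ do rewrite ltnNge leq_addl /= addnK -f_z0.
rewrite sumrN IH; last by rewrite size_belast.
have -> : (y' == [::]) = (y == [::]).
  by rewrite -!size_eq0 size_belast.
by rewrite subrr.
Qed.

Lemma ntwos_rcons x a : ntwos (rcons x a) = (ntwos x + a)%N.
Proof. by rewrite /ntwos -cats1 count_cat /= addn0; case: a. Qed.

Lemma ntwos_size x : (ntwos x <= size x)%N.
Proof. exact: count_size. Qed.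

(** The divided difference at the suffix sums of x has order size x, and
    pol y v is a polynomial in y of degree ntwos v. *)
Lemma sum_f0_pol x v : (ntwos v < size x)%N ->
  \sum_(0 <= i < (rank x).+1) f R x i 0 * pol i%:R v = 0.
Proof.
elim: v x => [|[] v IH] x; [|rewrite /ntwos /= add1n => vx|exact: IH].
  case: x => // a x _; under eq_bigr do rewrite mulr1; exact: sum_f0.
case: x vx => // a x; rewrite /= ltnS => vx.
transitivity (\sum_(0 <= i < (rank (a :: x)).+1)
    (((rank (a :: x))%:R - i%:R) * f R (a :: x) i 0 * pol i%:R v +
     ((rank v).+1%:R - (rank (a :: x))%:R) * (f R (a :: x) i 0 * pol i%:R v))).
  by apply: eq_bigr => i _; rewrite /pol /=; ring.
rewrite big_split /= sum_f_cons IH// add0r -mulr_sumr IH ?mulr0//.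
exact: leqW.
Qed.

(** Both words are read from the right.  As long as the last digits agree, the
    recursion for f peels them off, up to sums to which [sum_f0_pol] applies, because
    a word x has at least as many digits as the digits 2 of any word of the same rank,
    with equality for words of 2 only. *)
Lemma sum_f_pol_eq x v : rank x = rank v ->
  \sum_(0 <= i < (rank x).+1) f R x i (csuf x v) * pol i%:R v = (x == v)%:R.
Proof.
elim/last_ind: x v => [|x a IH] v.
  rewrite rank_nil => /esym/eqP; rewrite rank_eq0 => /eqP ->.
  by rewrite big_nat1 f_nil mul1r.
case/lastP: v => [|v b]; first by rewrite rank_nil rank_rcons addnC; case: (a).
have lt_twos y c u d : rank (rcons y c) = rank (rcons u d) -> ~~ (c && d) ->
    (ntwos (rcons u d) < size (rcons y c))%N.
  rewrite !rank_rcons !rank_size size_rcons ntwos_rcons.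
  have := ntwos_size y; have := ntwos_size u.
  by case: c; case: d => //=; lia.
move=> exv; rewrite csuf_rcons eqseq_rcons.
have [eab|nab] := eqVneq a b; last first.
  rewrite andbF sum_f0_pol//; apply: lt_twos => //; by case: (a) (b) nab => [] [].
move: exv; rewrite -{}eab andbT => exv {b}.
have rxv : rank x = rank v by move: exv; rewrite !rank_rcons => /addIn.
case: a exv => exv; last first.
  transitivity (\sum_(0 <= i < (rank (rcons x false)).+1)
      f R (rcons x false) i 0 * pol i%:R (rcons v false) +
    \sum_(0 <= i < (rank (rcons x false)).+1)
      (if i is j.+1 then f R x j (csuf x v) else 0) * pol i%:R (rcons v false)).
    by rewrite -big_split /=; apply: eq_bigr => i _; rewrite f_rcons1 f_z0 mulrDl.
  rewrite sum_f0_pol ?lt_twos// add0r big_nat_recl// mul0r add0r.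
  rewrite rank_rcons addn1; under eq_bigr do rewrite pol_rcons1.
  exact: IH.
set x1 := rcons x false; set x11 := rcons x1 false.
set v1 := rcons v false; set v11 := rcons v1 false.
have rx1 : rank x1 = (rank x).+1 by rewrite rank_rcons addn1.
have rx11 : rank x11 = (rank x).+2 by rewrite rank_rcons rx1 addn1.
(* The final digits 2 behave like two pairs of final digits 1: the factor 1 - i of
   pol i (v2) cancels the denominator, and for i = 1 the missing terms cancel each
   other by [f0_rcons]. *)
have key i : f R (rcons x true) i (csuf x v).+1 * pol i%:R (rcons v true) =
    (f R x11 i 0 * pol i%:R v11 +
     (if i is j.+1 then f R x1 j 0 * pol j%:R v1 else 0)) +
    (if i is j.+2 then f R x j (csuf x v) * pol j%:R v else 0).
  have [->|i1] := eqVneq i 1%N.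
    rewrite f_two1 mul0r addr0 pol_rcons1 -mulrDl !f_z0.
    have := f0_rcons R false x1 1; rewrite mul1r /= subnn => ->.
    by rewrite addNr mul0r.
  rewrite f_rcons2//; have i1' := subr1n_neq0 R i1.
  case: i i1 i1' => [|[|i]] // _ i1; rewrite ?addr0 ?f_z0.
    rewrite subr0 divr1 !pol0 /dimw !tprod_rcons !mul1r; congr (_ * _).
    by apply: eq_tprod => m; rewrite -addnA.
  rewrite pol_rcons2 2!pol_rcons1 mulrA divfK//.
  by rewrite !mulrDl addrA.
under eq_bigr do rewrite key.
rewrite big_split big_split /= -(IH _ rxv).
have -> : rank (rcons x true) = (rank x).+2 by rewrite rank_rcons addn2.
rewrite -{1}rx11 sum_f0_pol ?add0r; last first.
  by apply: lt_twos; rewrite // !rank_rcons rxv.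
rewrite big_nat_recl// add0r -{1}rx1 sum_f0_pol ?add0r; last first.
  by apply: lt_twos; rewrite // !rank_rcons rxv.
by rewrite !big_nat_recl// !add0r.
Qed.

(** Both sides satisfy the same recursion on the leftmost digit of v, by
    [npaths_one], [npaths_two] and [f_cons], down to words v of the rank of x. *)
Lemma npaths_formula x v : (rank x <= rank v)%N ->
  (npaths x v)%:R =
  \sum_(0 <= i < (rank x).+1) f R x i (csuf x v) * pol i%:R v.
Proof.
elim: v x => [|b v IH] x; rewrite leq_eqVlt => /orP[/eqP xv|xv].
- by rewrite sum_f_pol_eq// npaths_eq// eq_sym.
- by move: xv; rewrite rank_nil.
- by rewrite sum_f_pol_eq// npaths_eq// eq_sym.
case: b xv => xv; last first.
  rewrite npaths_one; last by move: xv; rewrite rank_cons.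
  by rewrite csuf_consr// IH//; move: xv; rewrite rank_cons.
case: x xv => [|a x] xv.
  by rewrite npaths_nil rank_nil big_nat1 f_nil mul1r pol0.
have axv : (rank (a :: x) <= (rank v).+1)%N.
  by move: xv; rewrite [rank (true :: v)]rank_cons.
rewrite npaths_two// natrD natrM natrB// (IH x); last first.
  by move: axv; rewrite rank_cons; case: (a) => /=; lia.
rewrite csuf_consr//; set h := csuf (a :: x) v.
have -> : \sum_(0 <= i < (rank x).+1) f R x i (csuf x v) * pol i%:R v =
    \sum_(0 <= i < (rank x).+1) f R x i h * pol i%:R v.
  by apply: eq_bigr => i _; rewrite [f R x i h]f_minn -csuf_consl.
rewrite -(sum_f_cons a).
have -> : ((rank v).+1%:R - (rank (a :: x))%:R) * (npaths (a :: x) v)%:R =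
   ((rank v).+1%:R - (rank (a :: x))%:R) *
   \sum_(0 <= i < (rank (a :: x)).+1) f R (a :: x) i h * pol i%:R v.
  move: axv; rewrite leq_eqVlt => /orP[/eqP ->|axv]; first by rewrite subrr !mul0r.
  by rewrite IH.
rewrite mulr_sumr -big_split /=; apply: eq_bigr => i _.
by rewrite /pol /=; ring.
Qed.
End NumberOfPaths.

(** * Nearly harmonic functions attached to a suffix *)

Lemma suffix_consE (T : eqType) (b : T) s v :
  suffix s (b :: v) = (s == b :: v) || suffix s v.
Proof.
apply/suffixP/orP => [[[|c u] /= e]|[/eqP ->|/suffixP[u ->]]].
- by left; rewrite e.
- by right; case: e => _ ->; apply: suffix_suffix.
- by exists [::].
- by exists (b :: u).
Qed.

Section Relative.
Variable R : realType.
Implicit Types (s x v : seq bool) (F G : nat -> R).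

(** The product of F over the digits 2 of v which stand to the left of the suffix s;
    it is 0 if s is not a suffix of v. *)
Fixpoint relprod F s v : R :=
  if v == s then 1 else
  match v with
  | [::] => 0
  | false :: v' => relprod F s v'
  | true :: v' => F (rank v').+1 * relprod F s v'
  end.

Lemma relprod_id F s : relprod F s s = 1.
Proof. by case: s => [|b s] //=; rewrite eqxx. Qed.

Lemma relprod_small F s v : (rank v <= rank s)%N -> relprod F s v = (v == s)%:R.
Proof.
elim: v => [|b v IH] vs /=; first by case: eqP.
case: eqP => // _; have vs' : (rank v < rank s)%N.
  by move: vs; rewrite rank_cons; case: b => /=; lia.
rewrite IH ?(ltnW vs')//; case: eqP => [e|_]; first by rewrite e ltnn in vs'.
by case: b {vs}; rewrite ?mulr0.
Qed.

Lemma relprod_one F s v : (rank s <= rank v)%N ->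
  relprod F s (false :: v) = relprod F s v.
Proof.
by move=> sv /=; case: eqP => // e; move: sv; rewrite -e rank_cons /= add1n ltnn.
Qed.

Lemma relprod_two F s v : (rank s < (rank v).+2)%N ->
  relprod F s (true :: v) = F (rank v).+1 * relprod F s v.
Proof.
by move=> sv /=; case: eqP => // e; move: sv; rewrite -e rank_cons /= add2n ltnn.
Qed.

Lemma relprod_div F G s v : (forall m, G m.+1 != 0) ->
  relprod (fun m => F m / G m) s v * tprod G v = relprod F s v * tprod G s.
Proof.
move=> G0; elim: v => [|b v IH] /=; case: eqP => [<-|_]; rewrite ?mul0r//.
case: b => //; rewrite -[in RHS]mulrA -IH.
by have := G0 (rank v); move=> ?; field.
Qed.

Lemma relprod_suffix F s v : suffix s v -> tprod F v = tprod F s * relprod F s v.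
Proof.
elim: v => [|b v IH].
  by rewrite suffixs0 => /eqP ->; rewrite relprod_id mulr1.
rewrite [relprod _ _ _]/=; case: eqP => [-> _|ne]; first by rewrite mulr1.
rewrite suffix_consE => /orP[/eqP e|/IH]; first by case: ne.
by case: b {ne} => /= ->; rewrite // mulrCA.
Qed.

Lemma relprod_nsuffix F s v : ~~ suffix s v -> relprod F s v = 0.
Proof.
elim: v => [|b v IH]; first by rewrite suffixs0 eq_sym /= => /negbTE ->.
rewrite suffix_consE negb_or => /andP[/negbTE + /IH e] /=.
by rewrite eq_sym e mulr0 => ->; case: b.
Qed.

(** How far relprod F s is from being harmonic at v. *)
Definition defect F s v := \sum_(u <- downs v) relprod F s u - relprod F s v.

Lemma defect_one F s v : (rank s <= rank v)%N -> defect F s (false :: v) = 0.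
Proof. by move=> sv; rewrite /defect big_seq1 relprod_one// subrr. Qed.

(** The leading term cancels because the lower neighbours 1v and 2u of 2v contribute
    relprod v and (rank v - z) relprod u, while 2v itself contributes
    (rank v + 1 - z) relprod v. *)
Lemma defect_two z s v : (rank s <= rank v)%N ->
  defect (fun m => m%:R - z) s (true :: v) =
  ((rank v)%:R - z) * defect (fun m => m%:R - z) s v.
Proof.
move=> sv; rewrite /defect /= big_cons big_map -/(relprod _ s (false :: v)).
rewrite -/(relprod _ s (true :: v)) relprod_one// relprod_two; last lia.
under eq_big_seq => u /rank_downs vu.
  rewrite relprod_two; last lia.
  rewrite -vu; over.
by rewrite -mulr_sumr -natr1; ring.
Qed.

Lemma defect_small F s v : (rank s <= rank v <= (rank s).+1)%N ->
  `|defect F s v| <= 1.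
Proof.
move=> /andP[sv vs]; rewrite /defect.
have -> : \sum_(u <- downs v) relprod F s u = (s \in downs v)%:R.
  rewrite -count_uniq_mem ?uniq_downs// -sum1_count [in RHS]big_mkcond natr_sum.
  apply: eq_big_seq => u /rank_downs vu; rewrite relprod_small; last lia.
  by rewrite /=; case: eqP.
have [vs'|sv'] := leqP (rank v) (rank s).
  rewrite relprod_small//; have -> : s \in downs v = false.
    by apply/negP => /rank_downs; lia.
  by case: eqP; rewrite ?sub0r ?normrN ?normr1 ?subr0 ?normr0.
case: v sv vs sv' => [|[] v] sv vs sv'; first by move: sv'; rewrite rank_nil.
  rewrite relprod_two; last by move: sv'; rewrite rank_cons /=; lia.
  rewrite relprod_small; last by move: vs; rewrite rank_cons /=; lia.
  have -> : (v == s) = false.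
    by apply/eqP => e; move: vs; rewrite e rank_cons /=; lia.
  by rewrite mulr0 subr0; case: (_ \in _); rewrite ?normr1 ?normr0.
move: sv vs sv'; rewrite rank_cons add1n ltnS => _ vs sv.
rewrite relprod_one// relprod_small; last lia.
by rewrite inE eq_sym subrr normr0.
Qed.

(** By [defect_one] and [defect_two] the defect lives on the words obtained from
    words of rank at most rank s + 1 by adding digits 2 on the left.  Each such digit,
    added to a word of rank M, multiplies the defect by M - z and the dimension by
    M + 1, so that their ratio decreases like rank v to the power - (z + 1) / 2 at
    least, and z = 3 already suffices for a summable bound. *)
Lemma defect_bound (z : nat) s v : (3 <= z <= rank s)%N -> (rank s <= rank v)%N ->
  `|defect (fun m => m%:R - z%:R) s v| * ((rank v)%:R * ((rank v)%:R - 1)) <=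
  ((rank s).+1 * rank s)%:R * dimw R v.
Proof.
move=> /andP[z3 zs]; have [n] := ubnP (rank v); elim: n v => // n IH v.
rewrite ltnS => vn sv.
have [vs|] := leqP (rank v) (rank s).+1.
  apply: (@le_trans _ _ (1 * ((rank s).+1 * rank s)%:R)); last first.
    by rewrite mulrC ler_pM// ?ler0n// dimw_ge1.
  have v1 : (1 <= rank v)%N by lia.
  have -> : (rank v)%:R - 1 = (rank v).-1%:R :> R by rewrite -subn1 natrB.
  rewrite -natrM ler_pM// ?ler0n ?ler_nat ?defect_small ?sv//.
  by apply: leq_mul => //; lia.
case: v vn sv => [|[] v] vn sv vs; first by move: vs; rewrite rank_nil.
  move: vn sv vs; rewrite rank_cons /= => vn sv vs.
  have sv' : (rank s <= rank v)%N by lia.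
  rewrite defect_two// normrM ger0_norm; last by rewrite subr_ge0 ler_nat; lia.
  have := IH v ltac:(lia) sv'; rewrite /dimw /= -/(dimw R v).
  set D := `| _ |; set C := (_ * _)%:R; set M := (rank v)%:R.
  have D0 : 0 <= D by exact: normr_ge0.
  have -> : (2 + rank v)%:R = M + 2 :> R by rewrite addnC natrD.
  have -> : (rank v).+1%:R = M + 1 :> R by rewrite -natr1.
  have z3' : (3 : R) <= z%:R by rewrite ler_nat.
  have M0 : 0 <= M by rewrite /M.
  move=> DC; apply: (@le_trans _ _ ((M + 1) * (D * (M * (M - 1))))); last first.
    by rewrite [leRHS]mulrCA ler_wpM2l// addr_ge0.
  rewrite (_ : _ * D * _ = (M + 1) * (D * ((M - z%:R) * (M + 2)))); last by ring.
  by rewrite ler_wpM2l ?addr_ge0// ler_wpM2l//; nra.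
rewrite defect_one; last by move: vs; rewrite rank_cons /=; lia.
by rewrite normr0 mul0r mulr_ge0// ltW// dimw_gt0.
Qed.

(** Up to the factor dimw v, the mean of H / dimw at the word of rank n on a random
    path from v down to the empty word. *)
Definition wsum n (H : seq bool -> R) v := \sum_(x <- words n) (npaths x v)%:R * H x.

Lemma wsum_eq H v : wsum (rank v) H v = H v.
Proof.
rewrite /wsum (bigD1_seq v) ?uniq_words ?mem_words//= npaths_eq// eqxx mul1r.
rewrite big_seq_cond big1 ?addr0// => x /andP[]; rewrite mem_words => /eqP rx xv.
by rewrite npaths_eq// eq_sym (negbTE xv) mul0r.
Qed.

Lemma wsum_rec n H v : (n < rank v)%N ->
  wsum n H v = \sum_(u <- downs v) wsum n H u.
Proof.
move=> nv; rewrite /wsum exchange_big /=.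
apply: eq_big_seq => x; rewrite mem_words => /eqP rx.
by rewrite npaths_rec ?rx// natr_sum mulr_suml.
Qed.

Lemma wsum_dimw n v : (n <= rank v)%N -> wsum n (dimw R) v = dimw R v.
Proof.
have [k] := ubnP (rank v); elim: k v => // k IH v; rewrite ltnS => vk.
rewrite leq_eqVlt => /orP[/eqP ->|nv]; first exact: wsum_eq.
rewrite wsum_rec// -dimw_downs; last by rewrite -rank_eq0; lia.
by apply: eq_big_seq => u /rank_downs vu; apply: IH; lia.
Qed.

(** The defects met between the ranks n and rank v add up; the bound of
    [defect_bound] is a difference of inverses of consecutive ranks and telescopes. *)
Lemma wsum_relprod (z : nat) s v n :
  (3 <= z <= rank s)%N -> (rank s <= n <= rank v)%N ->
  `|wsum n (relprod (fun m => m%:R - z%:R) s) v - relprod (fun m => m%:R - z%:R) s v| <=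
  ((rank s).+1 * rank s)%:R * (n%:R^-1 - (rank v)%:R^-1) * dimw R v.
Proof.
move=> zs /andP[sn]; set F := fun m => _ - _; set C := (_ * _)%:R.
have [k] := ubnP (rank v); elim: k v => // k IH v; rewrite ltnS => vk.
rewrite leq_eqVlt => /orP[/eqP ->|nv].
  by rewrite wsum_eq !subrr mulr0 mul0r normr0.
rewrite wsum_rec//.
have -> : \sum_(u <- downs v) wsum n (relprod F s) u - relprod F s v =
    \sum_(u <- downs v) (wsum n (relprod F s) u - relprod F s u) + defect F s v.
  by rewrite /defect sumrB; ring.
have n0 : 0 < n%:R :> R by rewrite ltr0n; case/andP: zs; lia.
have v0 : 0 < (rank v)%:R :> R by rewrite ltr0n; lia.
have v1 : 0 < (rank v)%:R - 1 :> R by rewrite subr_gt0 ltr1n; case/andP: zs; lia.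
have -> : C * (n%:R^-1 - (rank v)%:R^-1) * dimw R v =
    C * (n%:R^-1 - ((rank v)%:R - 1)^-1) * dimw R v +
    C * dimw R v / ((rank v)%:R * ((rank v)%:R - 1)).
  by field; rewrite !gt_eqF.
apply: (le_trans (ler_normD _ _)); apply: lerD; last first.
  rewrite ler_pdivlMr ?mulr_gt0//; apply: defect_bound => //; lia.
apply: (le_trans (ler_norm_sum _ _ _)).
rewrite -dimw_downs; last by rewrite -rank_eq0; lia.
rewrite mulr_sumr big_seq [leRHS]big_seq; apply: ler_sum => u /rank_downs vu.
have -> : (rank v)%:R - 1 = (rank u)%:R :> R by rewrite vu -natr1; ring.
by apply: IH; lia.
Qed.
End Relative.

(** * Comparison of the products with powers of one of them *)

Section Powers.
Variable R : realType.
Implicit Types (s x v : seq bool).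

Definition linfac (i m : nat) : R := (m%:R - i%:R) / m%:R.

(** The product of (g - i) / g over the digits 2 to the left of s.  For i = 1 this
    is pi(v) / pi(s) when s is a nonempty suffix of v, see [ypi_suffix]. *)
Definition ratpi (i : nat) s v : R := relprod (linfac i) s v.

Lemma ratpi_dimw i s v :
  relprod (fun m => m%:R - i%:R) s v * dimw R s = ratpi i s v * dimw R v.
Proof. by rewrite -relprod_div// => m; rewrite pnatr_eq0. Qed.

Lemma pow_bounds (t : R) (i : nat) : 0 <= t <= 1 ->
  1 - i%:R * t <= (1 - t) ^+ i <= 1 - i%:R * t + i%:R ^+ 2 * t ^+ 2.
Proof.
move=> /andP[t0 t1]; elim: i => [|i /andP[IH1 IH2]].
  by rewrite mul0r expr0 subr0 expr0n mul0r addr0 lexx.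
rewrite exprSr -natr1; have i0 : 0 <= i%:R :> R by [].
have t1' : 0 <= 1 - t by lra.
apply/andP; split.
  apply: (@le_trans _ _ ((1 - i%:R * t) * (1 - t))); last exact: ler_wpM2r.
  have : 0 <= i%:R * (t * t) by rewrite !mulr_ge0.
  lra.
apply: (@le_trans _ _ ((1 - i%:R * t + i%:R ^+ 2 * t ^+ 2) * (1 - t))).
  exact: ler_wpM2r.
have h1 : 0 <= i%:R * (t * t) by rewrite !mulr_ge0.
have h2 : 0 <= i%:R * i%:R * (t * t * t) by rewrite !mulr_ge0.
have h3 : 0 <= t * t by rewrite !mulr_ge0.
rewrite !expr2; lra.
Qed.

(** Each factor satisfies 0 <= (1 - t)^i - (1 - i t) <= i^2 t^2 with t = 1 / g, and the
    sum of the squares of the 1 / g telescopes: when a digit 2 is put before a word of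
    rank M, then g = M + 1 and 1 / g^2 <= 1 / M - 1 / (M + 2). *)
Lemma ratpi_pow i s v : suffix s v -> (i <= rank s)%N -> (0 < rank s)%N ->
  [/\ 0 <= ratpi 1 s v <= 1, 0 <= ratpi i s v <= ratpi 1 s v ^+ i &
   ratpi 1 s v ^+ i <= ratpi i s v + i%:R ^+ 2 * ((rank s)%:R^-1 - (rank v)%:R^-1)].
Proof.
move=> + is_ s0; rewrite /ratpi; elim: v => [|b v IH].
  by rewrite suffixs0 => /eqP e; move: s0; rewrite e rank_nil.
rewrite suffix_consE; case: (eqVneq s (b :: v)) => [<- _|ne /orP[//|] /[dup] sv /IH].
  by rewrite !relprod_id subrr mulr0 addr0 expr1n !lexx !ler01.
have rsv : (rank s <= rank v)%N.
  by case/suffixP: sv => u ->; rewrite rank_cat leq_addl.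
have s0' : 0 < (rank s)%:R :> R by rewrite ltr0n.
have rsv' : (rank s)%:R <= (rank v)%:R :> R by rewrite ler_nat.
have v0 : 0 < (rank v)%:R :> R by lra.
case: b {ne} => [] [/andP[A0 A1] /andP[B0 BA] AB]; last first.
  rewrite !relprod_one// A0 A1 B0 BA; split=> //.
  apply: (le_trans AB); rewrite lerD2l ler_wpM2l ?sqr_ge0// lerD2l lerN2.
  by rewrite rank_cons natrD lef_pV2 ?posrE ?addr_gt0// lerDr.
rewrite !relprod_two; try lia.
set A := relprod _ s v in A0 A1 BA AB *; set B := relprod _ s v in B0 BA AB *.
set M : R := (rank v)%:R in v0 rsv' AB *.
set t : R := (rank v).+1%:R^-1.
have g0 : 0 < M + 1 by lra.
have tE : t = (M + 1)^-1 by rewrite /t -natr1.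
have t0 : 0 <= t by rewrite tE invr_ge0 ltW.
have t1 : t <= 1 by rewrite tE invf_le1//; lra.
have fE j : linfac j (rank v).+1 = 1 - j%:R * t.
  by rewrite /linfac mulrBl mulfV ?pnatr_eq0.
have it1 : i%:R * t <= 1.
  rewrite tE ler_pdivrMr// mul1r.
  have : i%:R <= (rank s)%:R :> R by rewrite ler_nat.
  lra.
have /andP[p1 p2] : 1 - i%:R * t <= (1 - t) ^+ i <= 1 - i%:R * t + i%:R ^+ 2 * t ^+ 2.
  by apply: pow_bounds; rewrite t0 t1.
rewrite !fE mul1r; have a0 : 0 <= 1 - t by lra.
have a1 : (1 - t) ^+ i <= 1 by rewrite exprn_ile1//; lra.
have b0 : 0 <= 1 - i%:R * t by lra.
have Ai1 : A ^+ i <= 1 by rewrite exprn_ile1.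
have ai0 : 0 <= (1 - t) ^+ i by rewrite exprn_ge0.
have Ai0 : 0 <= A ^+ i by rewrite exprn_ge0.
split.
- by rewrite mulr_ge0//= mulr_ile1//; lra.
- by rewrite mulr_ge0//= exprMn ler_pM.
have t2 : t ^+ 2 <= M^-1 - (M + 2)^-1.
  rewrite tE -subr_ge0.
  have -> : M^-1 - (M + 2)^-1 - (M + 1)^-1 ^+ 2 =
      (M * M + 2 * M + 2) / (M * (M + 2) * (M + 1) ^+ 2).
    by field; rewrite !gt_eqF//; lra.
  by rewrite divr_ge0 ?mulr_ge0 ?exprn_ge0 ?addr_ge0 ?mulr_ge0//; lra.
rewrite exprMn rank_cons natrD [dval true]/=.
have -> : (1 - t) ^+ i * A ^+ i = (1 - i%:R * t) * B + ((1 - t) ^+ i * (A ^+ i - B) +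
   ((1 - t) ^+ i - (1 - i%:R * t)) * B) by ring.
rewrite lerD2l.
have -> : (rank s)%:R^-1 - (2%:R + M)^-1 =
   ((rank s)%:R^-1 - M^-1) + (M^-1 - (M + 2)^-1) by rewrite [2%:R + M]addrC; ring.
rewrite [leRHS]mulrDr; apply: lerD.
  apply: (@le_trans _ _ (1 * (A ^+ i - B))); last by rewrite mul1r; lra.
  by rewrite ler_wpM2r// subr_ge0.
apply: (@le_trans _ _ (i%:R ^+ 2 * t ^+ 2 * 1)).
  by rewrite ler_pM//; lra.
by rewrite mulr1 ler_wpM2l ?sqr_ge0.
Qed.

Lemma ratpi_nseq i s m :
  ratpi i s (nseq m.+1 true ++ s) =
  linfac i (2 * m + rank s).+1 * ratpi i s (nseq m true ++ s).
Proof.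
have rm : rank (nseq m true ++ s) = (2 * m + rank s)%N.
  by elim: m => //= m IH; rewrite rank_cons IH /=; lia.
by rewrite /ratpi relprod_two rm//; lia.
Qed.

(** With M = rank s + 2m, a further digit 2 multiplies the square by
    (M / (M + 1))^2 <= M / (M + 2), and these bounds telescope. *)
Lemma ratpi1_small s m : (0 < rank s)%N ->
  0 <= ratpi 1 s (nseq m true ++ s) /\
  ratpi 1 s (nseq m true ++ s) ^+ 2 <= (rank s)%:R / ((rank s)%:R + 2 * m%:R).
Proof.
move=> s0; have s0' : 0 < (rank s)%:R :> R by rewrite ltr0n.
elim: m => [|m [IH0 IH]].
  by rewrite /ratpi relprod_id mulr0 addr0 divff ?gt_eqF// expr1n.
rewrite ratpi_nseq; set q := ratpi _ _ _ in IH0 IH *.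
set r : R := (rank s)%:R in s0' IH *; set M : R := r + 2 * m%:R in IH.
have M0 : 0 < M by rewrite ltr_wpDr// mulr_ge0.
have fE : linfac 1 (2 * m + rank s).+1 = M / (M + 1).
  rewrite /linfac -natr1 addrK natrD natrM addrC -/r -/M.
  by rewrite [_ + 1]addrC addrA [1 + _]addrC.
rewrite fE; split; first by rewrite mulr_ge0// divr_ge0//; lra.
rewrite exprMn.
have -> : r + 2 * m.+1%:R = M + 2 by rewrite /M -natr1; ring.
apply: (@le_trans _ _ ((M / (M + 1)) ^+ 2 * (r / M))).
  by rewrite ler_wpM2l ?sqr_ge0.
have -> : r / (M + 2) = (M / (M + 2)) * (r / M) by field; rewrite !gt_eqF//; lra.
apply: ler_wpM2r; first by rewrite divr_ge0// ltW.
rewrite -subr_ge0.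
have -> : M / (M + 2) - (M / (M + 1)) ^+ 2 = M / ((M + 2) * (M + 1) ^+ 2).
  by field; rewrite !gt_eqF//; lra.
by rewrite divr_ge0 ?mulr_ge0 ?sqr_ge0//; lra.
Qed.

(** When digits 2 are added in front of s, pi decreases to 0 by factors close to 1;
    the first value below b pi(s) is close to b pi(s). *)
Lemma ratpi1_approx s (b : R) : (0 < rank s)%N -> 0 < b < 1 ->
  exists m, `|ratpi 1 s (nseq m true ++ s) - b| <= (rank s)%:R^-1.
Proof.
move=> s0 /andP[b0 b1]; have s0' : 0 < (rank s)%:R :> R by rewrite ltr0n.
pose q m := ratpi 1 s (nseq m true ++ s).
(* q m ^ 2 <= r / (r + 2 m), which is below b ^ 2 once m > r / b ^ 2 *)
have [m0 qm0] : exists m, q m <= b.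
  pose m := Num.truncn ((rank s)%:R / b ^+ 2 : R).
  exists m.+1; have [q0 qs] := ratpi1_small m.+1 s0.
  have b2 : 0 < b ^+ 2 by rewrite exprn_gt0.
  rewrite -(@ler_pXn2r _ 2) ?nnegrE ?(ltW b0)//; apply: (le_trans qs).
  have lem : (rank s)%:R / b ^+ 2 < m.+1%:R by apply: truncnS_gt.
  rewrite ltr_pdivrMr// in lem.
  have mp : 0 < m.+1%:R :> R by [].
  rewrite ler_pdivrMr; last by rewrite addr_gt0// mulr_gt0.
  apply: ltW; apply: (lt_trans lem); rewrite mulrC ltr_pM2l//; lra.
have ex : exists m, q m <= b by exists m0.
case: (ex_minnP ex) => -[|m] qm min_m.
  by move: qm; rewrite /q /ratpi relprod_id leNgt b1.
exists m.+1; rewrite -/(q m.+1).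
have qmb : b < q m.
  by rewrite ltNge; apply/negP => /min_m; rewrite ltnn.
rewrite distrC ger0_norm ?subr_ge0//.
have -> : q m.+1 = (1 - (2 * m + rank s).+1%:R^-1) * q m.
  by rewrite /q ratpi_nseq /linfac mulrBl mulfV ?pnatr_eq0// mul1r.
set t := _^-1.
have tr : t <= (rank s)%:R^-1 by rewrite lef_pV2 ?posrE ?ltr0n// ler_nat; lia.
have t0 : 0 <= t by rewrite invr_ge0.
have t1 : t <= 1 by rewrite invf_le1 ?ltr0n// ler1n.
have : (1 - t) * b <= (1 - t) * q m.
  by apply: ler_wpM2l; [rewrite subr_ge0|exact: ltW].
have : t * b <= t * 1 by apply: ler_wpM2l => //; exact: ltW.
lra.
Qed.
End Powers.

(** * Infinite products along an infinite word *)

Lemma size_itail w k : size (itail w k) = k.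
Proof. by rewrite size_rev size_mkseq. Qed.

Lemma rank_itail w k : (k <= rank (itail w k))%N.
Proof. by rewrite rank_size size_itail leq_addr. Qed.

Lemma suffix_itail w k m : (k <= m)%N -> suffix (itail w k) (itail w m).
Proof.
move=> km; rewrite suffix_rev; apply/prefixP.
exists (map w (iota k (m - k))).
by rewrite /mkseq -map_cat -iotaD subnKC.
Qed.

Lemma ntwos_itail w k m : (k <= m)%N -> (ntwos (itail w k) <= ntwos (itail w m))%N.
Proof.
by move=> /(suffix_itail w)/suffixP[u ->]; rewrite /ntwos count_cat leq_addl.
Qed.

Lemma ntwos_cons a x : ntwos (a :: x) = (a + ntwos x)%N.
Proof. by rewrite /ntwos /=; case: a. Qed.

Lemma g_one x j : g (false :: x) j = g x j.
Proof. by []. Qed.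

Lemma g_two x j : g (true :: x) j = if (ntwos x).+1 == j then (rank x).+1 else g x j.
Proof. by []. Qed.

Lemma g_cat u x j : (j <= ntwos x)%N -> g (u ++ x) j = g x j.
Proof.
move=> jx; elim: u => // a u IH; rewrite cat_cons; case: a; rewrite ?g_one// g_two IH.
by case: eqP => // e; move: jx; rewrite -e /ntwos count_cat; lia.
Qed.

(** By [g_cat] the truncation that the definition of ig picks does not matter. *)
Lemma ig_itail w k j : (j <= ntwos (itail w k))%N -> ig w j = g (itail w k) j.
Proof.
move=> jk; rewrite /ig; set n0 := xget _ _.
have jn0 : (j <= ntwos (itail w n0))%N.
  by apply: (@xgetPex _ 0%N [set n | (j <= ntwos (itail w n))%N]); exists k.
case: (leqP n0 k) => [|/ltnW] /(suffix_itail w)/suffixP[u ->];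
  by rewrite g_cat.
Qed.

Lemma g_ge x j : (0 < j <= ntwos x)%N -> (j <= g x j)%N.
Proof.
elim: x => [|a x IH]; first by case: j.
move=> /andP[j0]; rewrite ntwos_cons; case: a => jx; last first.
  by rewrite g_one; apply: IH; rewrite j0.
rewrite g_two; case: eqP => [<-|ne].
  by rewrite rank_size ltnS leq_addl.
by apply: IH; rewrite j0 /=; lia.
Qed.

Section Products.
Variable R : realType.
Implicit Types (s x v : seq bool) (F : nat -> R).

Lemma tprodE F x : \prod_(1 <= j < (ntwos x).+1) F (g x j) = tprod F x.
Proof.
elim: x => [|a x IH]; first by rewrite big_geq.
rewrite ntwos_cons; case: a.
  rewrite add1n big_nat_recr// g_two eqxx [RHS]/= mulrC; congr (_ * _).
  rewrite -IH; apply: eq_big_nat => j /andP[_ jx].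
  by rewrite g_two gtn_eqF.
by rewrite add0n [RHS]/= -IH; apply: eq_bigr => j _; rewrite g_one.
Qed.

Definition pifactor (m : nat) : R := if (1 < m)%N then (m%:R - 1) / m%:R else 1.

Lemma ypiE x : ypi R x = tprod pifactor x.
Proof. by rewrite /ypi big_mkcond /= -tprodE. Qed.

Definition partial_prod (w : nat -> bool) F n :=
  \prod_(1 <= j < n.+1 | `[< le_itwos w j >]) F (ig w j).

Lemma partial_prod_itail w F k :
  partial_prod w F (ntwos (itail w k)) = tprod F (itail w k).
Proof.
rewrite -tprodE /partial_prod big_mkcond /=; apply: eq_big_nat => j /andP[j0 jk].
by rewrite asboolT ?(@ig_itail w k)//; exists k.
Qed.

(** Up to the constant u m0, the tail of u is a nonincreasing sequence of nonnegative
    numbers. *)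
Lemma cvg_contract (u c : nat -> R) m0 :
  (forall n, (m0 <= n)%N -> 0 <= c n <= 1) -> (forall n, u n.+1 = u n * c n) ->
  cvgn u.
Proof.
move=> c01 uc; pose d n := \prod_(i < n) c (m0 + i)%N.
have cd : cvgn d.
  apply: nonincreasing_is_cvgn.
    apply/nonincreasing_seqP => n; rewrite /d big_ord_recr /=.
    have /andP[c0 c1] := c01 (m0 + n)%N (leq_addr _ _).
    rewrite ler_piMr// prodr_ge0// => i _.
    by have /andP[] := c01 (m0 + i)%N (leq_addr _ _).
  exists 0 => _ [n _ <-]; apply: prodr_ge0 => i _.
  by have /andP[] := c01 (m0 + i)%N (leq_addr _ _).
have ud n : u (n + m0)%N = u m0 * d n.
  elim: n => [|n IH]; first by rewrite /d big_ord0 mulr1.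
  by rewrite addSn uc IH /d big_ord_recr /= mulrA [(m0 + n)%N]addnC.
apply/cvg_ex; exists (u m0 * limn d); rewrite -(cvg_shiftn m0).
rewrite (_ : [sequence _]_n = fun n => u m0 * d n); last first.
  by apply/funext => n; rewrite /= ud.
exact: cvgMr.
Qed.

Lemma is_cvg_partial_prod w F m0 : (forall m, (m0 <= m)%N -> 0 <= F m <= 1) ->
  cvgn (partial_prod w F).
Proof.
move=> F01; apply: (@cvg_contract _ (fun n => if `[< le_itwos w n.+1 >] then F (ig w n.+1) else 1) m0).
  move=> n mn; case: asboolP => [[k nk]|]; last by rewrite ler01 lexx.
  apply: F01; rewrite (@ig_itail w k)//.
  have := @g_ge (itail w k) n.+1 nk; lia.
move=> n; rewrite /partial_prod big_mkcond [in RHS]big_mkcond /=.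
by rewrite big_nat_recr.
Qed.

(** The products over the truncations of w are terms of the sequence of partial
    products; if w has finitely many digits 2, then both sequences are eventually
    constant. *)
Lemma cvg_tprod_itail w F m0 : (forall m, (m0 <= m)%N -> 0 <= F m <= 1) ->
  (fun k => tprod F (itail w k)) @ \oo --> iprod w (fun j => F (ig w j)).
Proof.
move=> F01; have /= cF := @is_cvg_partial_prod w F m0 F01.
rewrite /iprod -/(partial_prod w F).
rewrite (_ : (fun k => _) = partial_prod w F \o (fun k => ntwos (itail w k))); last first.
  by apply/funext => k /=; rewrite partial_prod_itail.
have [[D hb]|hu] := pselect (exists D, forall k, (ntwos (itail w k) <= D)%N).
  have exD : exists d, `[< exists k, ntwos (itail w k) = d >].
    by exists (ntwos (itail w 0)); apply/asboolP; exists 0%N.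
  have leD d : `[< exists k, ntwos (itail w k) = d >] -> (d <= D)%N.
    by move=> /asboolP[k <-].
  case: (ex_maxnP exD leD) => d /asboolP[k0 dk0] maxd.
  have {}maxd k : (ntwos (itail w k) <= d)%N by apply: maxd; apply/asboolP; exists k.
  have cst n : (d <= n)%N -> partial_prod w F n = partial_prod w F d.
    move=> dn; rewrite /partial_prod big_mkcond [RHS]big_mkcond /=.
    rewrite (@big_cat_nat _ _ _ d.+1)//= [X in _ * X = _](_ : _ = 1) ?mulr1//.
    rewrite big_nat big1// => j /andP[dj _]; rewrite asboolF// => -[k jk].
    by have := maxd k; rewrite leqNgt (leq_trans dj).
  have -> : limn (partial_prod w F) = partial_prod w F d.
    apply/cvg_lim => //; apply: cvg_near_cst.
    by near=> n; apply: cst; near: n; exact: nbhs_infty_ge.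
  apply: cvg_near_cst; near=> k => /=; congr (partial_prod _ _ _).
  apply/eqP; rewrite eqn_leq maxd -dk0 ntwos_itail//.
  by near: k; exact: nbhs_infty_ge.
have unb D : exists k, (D < ntwos (itail w k))%N.
  apply: contrapT => h; apply: hu; exists D => k; rewrite leqNgt; apply/negP => kD.
  by apply: h; exists k.
apply: cvg_comp cF; apply/cvgnyPge => D.
have [k0 Dk0] := unb D; near=> k.
apply: (leq_trans (ltnW Dk0)); apply: ntwos_itail; near: k; exact: nbhs_infty_ge.
Unshelve. all: by end_near. Qed.

Lemma cvg_ypi_itail w :
  (fun k => ypi R (itail w k)) @ \oo --> iypi R w.
Proof.
under eq_fun do rewrite ypiE.
apply: (@cvg_tprod_itail w pifactor 0) => m _; rewrite /pifactor.
case: ltnP => m1; last by rewrite ler01 lexx.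
have m0 : 0 < m%:R :> R by rewrite ltr0n; lia.
have m1' : 1 < m%:R :> R by rewrite ltr1n.
by rewrite ler_pdivlMr// ler_pdivrMr// mul0r mul1r; apply/andP; split; lra.
Qed.

Lemma cvg_linfac_itail w i :
  (fun k => tprod (@linfac R i) (itail w k)) @ \oo -->
  iprod w (fun j => ((ig w j)%:R - i%:R) / (ig w j)%:R : R).
Proof.
apply: (@cvg_tprod_itail w (@linfac R i) i.+1) => m im; rewrite /linfac.
have m0 : 0 < m%:R :> R by rewrite ltr0n; lia.
have m1' : i%:R <= m%:R :> R by rewrite ler_nat; lia.
have i0 : 0 <= i%:R :> R by [].
by rewrite ler_pdivlMr// ler_pdivrMr// mul0r mul1r; apply/andP; split; lra.
Qed.
End Products.

(** * Random paths from a finite word *)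

Lemma prefix_take_lcp r t j : (j <= size t)%N -> prefix (take j t) r = (j <= lcp r t)%N.
Proof.
elim: r t j => [|a r IH] [|c t] [|j] //= jt.
by rewrite eq_sym; case: eqP => //= _; rewrite IH.
Qed.

Lemma lcp_size r t : (lcp r t <= size r)%N.
Proof. by elim: r t => [|a r IH] [|c t] //=; case: ifP => // _; rewrite ltnS. Qed.

(** The definition of hsuf only reads the last size x digits of w. *)
Lemma csuf_hsuf x w k v : (size x <= k)%N -> suffix (itail w k) v ->
  csuf x v = hsuf x w.
Proof.
move=> xk /suffixP[u ->]; rewrite /csuf.
set t := rev (u ++ _); have tE : t = mkseq w k ++ rev u by rewrite /t rev_cat revK.
have st : (size x <= size t)%N by rewrite tE size_cat size_mkseq; lia.
have pre j : (j <= size x)%N -> suffix (itail w j) x = (j <= lcp (rev x) t)%N.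
  move=> jx; rewrite -prefix_take_lcp; last lia.
  rewrite -prefix_rev /itail revK; congr prefix.
  rewrite tE takel_cat ?size_mkseq; last lia.
  by rewrite /mkseq -map_take take_iota (minn_idPl _)//; lia.
have lx : (lcp (rev x) t < (size x).+1)%N.
  by rewrite ltnS (leq_trans (lcp_size _ _))// size_rev.
apply/eqP; rewrite eqn_leq; apply/andP; split.
  rewrite -[lcp _ _]/(nat_of_ord (Ordinal lx)) /hsuf.
  by rewrite (@leq_bigmax_cond _ _ _ (Ordinal lx))//= pre//; rewrite -ltnS.
by apply/bigmax_leqP => i; rewrite pre//; rewrite -ltnS.
Qed.

Section Passage.
Variable R : realType.
Implicit Types (s x v : seq bool).

(** The probability that a uniformly chosen path from v down to the empty word goes
    through x. *)
Definition passage v x : R := dimw R x * (npaths x v)%:R / dimw R v.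

Lemma passage_ge0 v x : 0 <= passage v x.
Proof. by rewrite /passage divr_ge0 ?mulr_ge0 ?(ltW (dimw_gt0 _ _)). Qed.

Lemma sum_passage n v : (n <= rank v)%N -> \sum_(x <- words n) passage v x = 1.
Proof.
move=> nv; have := @wsum_dimw R n v nv; rewrite /wsum => e.
rewrite -mulr_suml; under eq_bigr do rewrite mulrC.
by rewrite e divff// gt_eqF// dimw_gt0.
Qed.

Lemma passage_formula v x : (rank x <= rank v)%N ->
  passage v x = dimw R x *
   \sum_(0 <= i < (rank x).+1) f R x i (csuf x v) * tprod (@linfac R i) v.
Proof.
move=> xv; rewrite /passage -mulrA; congr (_ * _).
rewrite (npaths_formula R xv) mulr_suml; apply: eq_bigr => i _.
rewrite -mulrA; congr (_ * _); rewrite /pol /dimw.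
elim: v {xv} => [|[] v IH] //=; first by rewrite divr1.
rewrite /linfac -IH invfM; ring.
Qed.

(** The left-hand sum is the mean of ratpi i s at the word of rank n on a random path
    from v. *)
Lemma passage_ratpi (i : nat) s v n : (3 <= i <= rank s)%N ->
  (rank s <= n <= rank v)%N ->
  `|\sum_(x <- words n) passage v x * ratpi R i s x - ratpi R i s v| <=
  ((rank s).+1 * rank s)%:R * dimw R s / n%:R.
Proof.
move=> is_ /andP[sn nv]; have s0 := dimw_gt0 R s; have v0 := dimw_gt0 R v.
have n0 : 0 < n%:R :> R by rewrite ltr0n; case/andP: is_; lia.
have rv0 : 0 < (rank v)%:R :> R by rewrite ltr0n; case/andP: is_; lia.
have relE x : ratpi R i s x =
    relprod (fun m => m%:R - i%:R) s x * dimw R s / dimw R x.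
  by rewrite ratpi_dimw mulfK// gt_eqF// dimw_gt0.
have -> : \sum_(x <- words n) passage v x * ratpi R i s x =
    wsum n (relprod (fun m => m%:R - i%:R) s) v * dimw R s / dimw R v.
  rewrite /wsum !mulr_suml; apply: eq_bigr => x _; rewrite relE /passage.
  by field; rewrite !gt_eqF// dimw_gt0.
rewrite relE -!mulrBl !normrM (gtr0_norm s0) normfV (gtr0_norm v0).
rewrite ler_pdivrMr//.
have := @wsum_relprod R i s v n is_ (_ : (rank s <= n <= rank v)%N).
rewrite sn nv => /(_ isT) /(ler_wpM2r (ltW s0)) h; apply: (le_trans h).
set C := (_ * _)%:R.
have -> : C * dimw R s / n%:R * dimw R v = C * n%:R^-1 * dimw R v * dimw R s by ring.
rewrite ler_wpM2r ?(ltW s0)// ler_wpM2r ?(ltW v0)// ler_wpM2l//.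
by rewrite gerBl invr_ge0 ltW.
Qed.

Lemma ratpi_nsuffix i s x : ~~ suffix s x -> ratpi R i s x = 0.
Proof. exact: relprod_nsuffix. Qed.

Lemma ratpi3_sq s x : (6 <= rank s)%N ->
  ratpi R 3 s x ^+ 2 <= ratpi R 6 s x + 36 / (rank s)%:R.
Proof.
move=> s6; have s0 : 0 < (rank s)%:R :> R by rewrite ltr0n; lia.
have [sx|nsx] := boolP (suffix s x); last first.
  by rewrite !ratpi_nsuffix// expr0n add0r divr_ge0// ltW.
have [/andP[q0 q1] /andP[a0 a1] _] := @ratpi_pow R 3 s x sx ltac:(lia) ltac:(lia).
have [_ _ b2] := @ratpi_pow R 6 s x sx ltac:(lia) ltac:(lia).
apply: (@le_trans _ _ ((ratpi R 1 s x ^+ 3) ^+ 2)); first by rewrite lerXn2r ?nnegrE// exprn_ge0.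
rewrite -exprM; apply: (le_trans b2); rewrite lerD2l -natrX mulrBr.
by rewrite gerBl mulr_ge0// invr_ge0.
Qed.

Lemma ratpi3_ge s x : (6 <= rank s)%N ->  suffix s x ->
  ratpi R 1 s x ^+ 3 <= ratpi R 3 s x + 9 / (rank s)%:R.
Proof.
move=> s6 sx.
have [_ _ b2] := @ratpi_pow R 3 s x sx ltac:(lia) ltac:(lia).
apply: (le_trans b2); rewrite lerD2l -natrX mulrBr.
by rewrite gerBl mulr_ge0// invr_ge0.
Qed.

(** The mean of (Q3 - c)^2 with Qi = ratpi i s is computed from the means of Q6, which
    is close to Q3^2, and of Q3; both are close to the values at v, hence to the powers
    Q1(v)^6 and Q1(v)^3.  The constant 54 is 36 + 2 * 9, where 36 and 9 are the squares
    of the exponents, see [ratpi_pow]. *)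
Lemma passage_variance s v n (c : R) : 0 <= c <= 1 -> (6 <= rank s)%N ->
  suffix s v -> (rank s <= n <= rank v)%N ->
  \sum_(x <- words n) passage v x * (ratpi R 3 s x - c) ^+ 2 <=
  (ratpi R 1 s v ^+ 3 - c) ^+ 2 + 54 / (rank s)%:R +
    3 * (((rank s).+1 * rank s)%:R * dimw R s / n%:R).
Proof.
move=> /andP[c0 c1] s6 sv snv; set D := (X in 3 * X).
have := @passage_ratpi 3 s v n ltac:(lia) snv.
have := @passage_ratpi 6 s v n ltac:(lia) snv.
rewrite -/D !ler_norml => /andP[_ h6] /andP[h3 _].
have s3 := ratpi3_ge s6 sv.
have [_ /andP[_ v6] _] := @ratpi_pow R 6 s v sv ltac:(lia) ltac:(lia).
have D0 : 0 <= D by rewrite /D !mulr_ge0 ?invr_ge0// ltW// dimw_gt0.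
have r0 : 0 <= (rank s)%:R^-1 :> R by rewrite invr_ge0.
set S3 := \sum_(_ <- _) _ in h3; set S6 := \sum_(_ <- _) _ in h6.
apply: (@le_trans _ _ (S6 + 36 / (rank s)%:R - 2 * c * S3 + c ^+ 2)).
  have nv : (n <= rank v)%N by case/andP: snv.
  set a := 36 / _.
  have -> : S6 + a - 2 * c * S3 + c ^+ 2 = \sum_(x <- words n)
      (passage v x * ratpi R 6 s x + a * passage v x - 2 * c * (passage v x * ratpi R 3 s x) +
       c ^+ 2 * passage v x).
    by rewrite !big_split /= sumrN -!mulr_sumr (sum_passage nv) !mulr1.
  apply: ler_sum => x _.
  have := ratpi3_sq x s6; have := passage_ge0 v x; set T := passage _ _ => T0 h.
  have : T * ratpi R 3 s x ^+ 2 <= T * (ratpi R 6 s x + a).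
    by rewrite ler_wpM2l.
  lra.
have -> : (ratpi R 1 s v ^+ 3 - c) ^+ 2 =
    ratpi R 1 s v ^+ 6 - 2 * c * ratpi R 1 s v ^+ 3 + c ^+ 2 by ring.
have k1 : c * (ratpi R 1 s v ^+ 3 - 9 / (rank s)%:R - D) <= c * S3.
  by rewrite ler_wpM2l//; lra.
have k2 : c * (9 / (rank s)%:R + D) <= 1 * (9 / (rank s)%:R + D).
  by rewrite ler_wpM2r// addr_ge0// mulr_ge0.
lra.
Qed.
End Passage.

(** * The measure as a limit *)

Lemma eq_relprod (R : realType) (F G : nat -> R) s v :
  (forall m, (rank s < m)%N -> F m = G m) -> relprod F s v = relprod G s v.
Proof.
move=> FG; elim: v => [|b v IH] //=; case: eqP => // ne.
case: b {ne} => //; have [vs|sv] := ltnP (rank v) (rank s).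
  rewrite !relprod_small ?(ltnW vs)//.
  by case: eqP => [e|_]; rewrite ?mulr0//; rewrite e ltnn in vs.
by rewrite IH FG.
Qed.

Lemma ypi_suffix (R : realType) s x : (0 < rank s)%N -> suffix s x ->
  ypi R x = ypi R s * ratpi R 1 s x.
Proof.
move=> s0 sx; rewrite !ypiE (relprod_suffix _ sx); congr (_ * _).
by apply: eq_relprod => m sm; rewrite /pifactor /linfac ifT//; lia.
Qed.

Lemma cvg_sum_seq (R : realType) (I : Type) (r : seq I) (P : pred I)
    (u : I -> nat -> R) (l : I -> R) : (forall i, u i @ \oo --> l i) ->
  (fun n => \sum_(i <- r | P i) u i n) @ \oo --> \sum_(i <- r | P i) l i.
Proof.
move=> ul; elim: r => [|i r IH].
  by under eq_fun do rewrite big_nil; rewrite big_nil; exact: cvg_cst.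
under eq_fun do rewrite big_cons; rewrite big_cons; case: ifP => _ //.
exact: cvgD.
Qed.

Section Approximation.
(* The words V k stand for w and b; they exist by [approximants]. *)
Variables (R : realType) (w : nat -> bool) (b : R) (V : nat -> seq bool).
Let s k := itail w k.+1.
Hypothesis sV : forall k, suffix (s k) (V k).
Hypothesis Vb : forall k, `|ratpi R 1 (s k) (V k) - b| <= k.+1%:R^-1.

Lemma rank_approx k : (k < rank (V k))%N.
Proof.
case/suffixP: (sV k) => u ->; rewrite rank_cat.
by have := rank_itail w k.+1; rewrite -/(s k); lia.
Qed.

Lemma cvg_ratpi1_approx : (fun k => ratpi R 1 (s k) (V k)) @ \oo --> b.
Proof.
apply/cvgrPdist_le => e e0; near=> k; rewrite distrC.
apply: (le_trans (Vb k)); apply: ltW; near: k.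
exact: (near_infty_natSinv_lt (PosNum e0)).
Unshelve. all: by end_near. Qed.

(** The error of [ratpi_pow] tends to 0 because the rank of the suffix s k tends to
    infinity. *)
Lemma cvg_ratpi_approx i : (fun k => ratpi R i (s k) (V k)) @ \oo --> b ^+ i.
Proof.
have c1 : (fun k => ratpi R 1 (s k) (V k) ^+ i) @ \oo --> b ^+ i.
  exact: (cvg_comp _ _ cvg_ratpi1_approx (@exprn_continuous R i b)).
have c2 : (fun k => ratpi R 1 (s k) (V k) ^+ i - i%:R ^+ 2 * harmonic k) @ \oo --> b ^+ i.
  rewrite -[X in _ --> X]subr0 -(mulr0 (i%:R ^+ 2)).
  by apply: cvgB c1 _; apply: cvgMr; exact: cvg_harmonic.
apply: (squeeze_cvgr _ c2 c1); near=> k.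
have ik : (i <= k)%N by near: k; exact: nbhs_infty_ge.
have rk := rank_itail w k.+1; rewrite -/(s k) in rk.
have [_ /andP[_ ->] h] := @ratpi_pow R i (s k) (V k) (sV k) ltac:(lia) ltac:(lia).
rewrite andbT lerBlDr (le_trans h)// lerD2l ler_wpM2l ?sqr_ge0// /harmonic /=.
apply: (@le_trans _ _ (rank (s k))%:R^-1).
  by rewrite gerBl invr_ge0.
by rewrite lef_pV2 ?posrE ?ltr0n ?ler_nat//; lia.
Unshelve. all: by end_near. Qed.

Lemma cvg_tprod_approx i : (fun k => tprod (@linfac R i) (V k)) @ \oo -->
  b ^+ i * iprod w (fun j => ((ig w j)%:R - i%:R) / (ig w j)%:R : R).
Proof.
under eq_fun => k do rewrite (relprod_suffix _ (sV k)) mulrC.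
apply: cvgM; first exact: cvg_ratpi_approx.
rewrite (_ : (fun k => _) = [sequence tprod (@linfac R i) (itail w (k + 1)%N)]_k); last first.
  by apply/funext => k; rewrite /= addn1.
by rewrite (@cvg_shiftn 1 _ (fun k => tprod (@linfac R i) (itail w k))); exact: cvg_linfac_itail.
Qed.

Lemma cvg_ypi_tail : (fun k => ypi R (s k)) @ \oo --> iypi R w.
Proof.
rewrite (_ : (fun k => _) = [sequence ypi R (itail w (k + 1)%N)]_k); last first.
  by apply/funext => k; rewrite /= addn1.
rewrite (@cvg_shiftn 1 _ (fun k => ypi R (itail w k))); exact: cvg_ypi_itail.
Qed.

Lemma rank_tail_gt0 k : (0 < rank (s k))%N.
Proof. by have := rank_itail w k.+1; rewrite -/(s k); lia. Qed.

Lemma cvg_ypi_approx : (fun k => ypi R (V k)) @ \oo --> iypi R w * b.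
Proof.
under eq_fun => k do rewrite (ypi_suffix R (rank_tail_gt0 k) (sV k)).
by apply: cvgM; [exact: cvg_ypi_tail|exact: cvg_ratpi1_approx].
Qed.

(** By [passage_formula] the passage probability is a fixed linear combination of the
    products over V k, whose limits are the products over w times powers of b. *)
Lemma cvg_passage x : (fun k => passage R (V k) x) @ \oo --> mu w b x.
Proof.
rewrite /mu npaths_nil /dprime.
pose G k := dimw R x * \sum_(0 <= i < (rank x).+1)
  f R x i (hsuf x w) * tprod (@linfac R i) (V k).
have : G @ \oo --> dimw R x * \sum_(0 <= i < (rank x).+1)
    b ^+ i * f R x i (hsuf x w) *
    iprod w (fun j => ((ig w j)%:R - i%:R) / (ig w j)%:R : R).
  apply: cvgMr; apply: cvg_sum_seq => i.
  rewrite (mulrC (b ^+ i)) -mulrA.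
  apply: cvgMr; exact: cvg_tprod_approx.
apply: cvg_trans; apply: near_eq_cvg; near=> k.
have xk : (rank x <= k)%N by near: k; exact: nbhs_infty_ge.
have rk := rank_approx k.
rewrite passage_formula; last lia.
rewrite /G (@csuf_hsuf x w k.+1)//; last exact: sV.
by have := rank_size x; lia.
Unshelve. all: by end_near. Qed.

Lemma mu_sum n : \sum_(x <- words n) mu w b x = 1.
Proof.
have c : (fun k => \sum_(x <- words n) passage R (V k) x) @ \oo -->
    \sum_(x <- words n) mu w b x.
  by apply: cvg_sum_seq => x; exact: cvg_passage.
have c1 : (fun k => \sum_(x <- words n) passage R (V k) x) @ \oo --> (1 : R).
  apply: cvg_near_cst; near=> k.
  have nk : (n <= k)%N by near: k; exact: nbhs_infty_ge.
  by rewrite sum_passage//; have := rank_approx k; lia.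
exact: (cvg_unique _ c c1).
Unshelve. all: by end_near. Qed.

Lemma mu_ge0 x : 0 <= mu w b x.
Proof.
apply: (@ler_cvg_to _ _ _ _ (fun=> 0) _ _ _ (cvg_cst 0) (cvg_passage (x := x))).
by near=> k; exact: passage_ge0.
Unshelve. all: by end_near. Qed.

(** Chebyshev inequality for ratpi 3 (s k), with k fixed: [passage_variance] holds along
    the words V m, and m tends to infinity. *)
Lemma mu_chebyshev (A : set (seq bool)) n k (eta : R) :
  0 <= b <= 1 -> 0 < eta -> (5 < k)%N -> (rank (s k) <= n)%N ->
  (forall x, A x -> eta <= `|ratpi R 3 (s k) x - b ^+ 3|) ->
  eta ^+ 2 * \sum_(x <- words n | x \in A) mu w b x <=
  ((iypi R w * b / ypi R (s k)) ^+ 3 - b ^+ 3) ^+ 2 + 54 / (rank (s k))%:R +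
    3 * (((rank (s k)).+1 * rank (s k))%:R * dimw R (s k) / n%:R).
Proof.
move=> /andP[b0 b1] eta0 k5 kn far.
have sk6 : (6 <= rank (s k))%N.
  by have := rank_itail w k.+1; rewrite -/(s k); lia.
have pos m : suffix (s k) (V m) -> ypi R (s k) != 0 -> ratpi R 1 (s k) (V m) = ypi R (V m) / ypi R (s k).
  by move=> sm y0; rewrite (ypi_suffix R (rank_tail_gt0 k) sm) [RHS]mulrC mulKf.
have y0 : ypi R (s k) != 0.
  rewrite ypiE gt_eqF//; elim: (s k) => //= -[] u // IH.
  by rewrite mulr_gt0// /pifactor; case: ltnP => // u1; rewrite divr_gt0// subr_gt0 ltr1n.
set D := (X in 3 * X); set K := 54 / _.
have suf m : (k <= m)%N -> suffix (s k) (V m).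
  by move=> km; apply: suffix_trans (sV m); exact: suffix_itail.
have c1 : (fun m => eta ^+ 2 * \sum_(x <- words n | x \in A) passage R (V m) x) @ \oo -->
    eta ^+ 2 * \sum_(x <- words n | x \in A) mu w b x.
  by apply: cvgMr; apply: cvg_sum_seq => x; exact: cvg_passage.
have c2 : (fun m => ((ypi R (V m) / ypi R (s k)) ^+ 3 - b ^+ 3) ^+ 2 + K + 3 * D) @ \oo -->
    ((iypi R w * b / ypi R (s k)) ^+ 3 - b ^+ 3) ^+ 2 + K + 3 * D.
  apply: cvgD; last exact: cvg_cst.
  apply: cvgD; last exact: cvg_cst.
  have c3 : (fun m => (ypi R (V m) / ypi R (s k)) ^+ 3 - b ^+ 3) @ \oo -->
      (iypi R w * b / ypi R (s k)) ^+ 3 - b ^+ 3.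
    apply: cvgB; last exact: cvg_cst.
    have c4 : (fun m => ypi R (V m) / ypi R (s k)) @ \oo --> iypi R w * b / ypi R (s k).
      by apply: cvgMl; exact: cvg_ypi_approx.
    exact: (cvg_comp _ _ c4 (@exprn_continuous R 3 _)).
  exact: (cvg_comp _ _ c3 (@exprn_continuous R 2 _)).
apply: (ler_cvg_to c1 c2); near=> m.
have nm : (n <= m)%N by near: m; exact: nbhs_infty_ge.
have km : (k <= m)%N by near: m; exact: nbhs_infty_ge.
rewrite -pos; [|exact: suf|exact: y0].
have rm := rank_approx m.
apply: le_trans (@passage_variance R (s k) (V m) n (b ^+ 3) _ sk6 (suf _ km) _); last 2 first.
- by rewrite exprn_ge0//= exprn_ile1.
- by rewrite kn; lia.
rewrite mulr_sumr big_mkcond /=; apply: ler_sum => x _.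
case: ifPn => [xA|_]; last by rewrite mulr_ge0 ?passage_ge0 ?sqr_ge0.
rewrite mulrC ler_wpM2l ?passage_ge0// -[leRHS]real_normK ?num_real//.
by rewrite lerXn2r ?nnegrE ?(ltW eta0)//; apply: far; rewrite inE in xA.
Unshelve. all: by end_near. Qed.
End Approximation.

(** * Concentration *)

Section Concentration.
Variables (R : realType) (w : nat -> bool) (b e : R).
Let s k := itail w k.+1.
Hypotheses (hw : 0 < iypi R w) (b0 : 0 < b) (b1 : b < 1) (e0 : 0 < e).

Lemma cvg_inv_rank_tail : (fun k => (rank (s k))%:R^-1 : R) @ \oo --> (0 : R).
Proof.
apply: (squeeze_cvgr _ (cvg_cst 0) (@cvg_harmonic R)); near=> k.
have := rank_itail w k.+1; rewrite -/(s k) => rk.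
by rewrite invr_ge0 ler0n /= /harmonic /= lef_pV2 ?posrE ?ltr0n ?ler_nat//; lia.
Unshelve. all: by end_near. Qed.

(** Suppose that ratpi 3 (s k) x is close to b^3.  Then it is not 0, hence s k is a
    suffix of x; moreover the cube of ratpi 1 (s k) x is close to b^3, so that
    ratpi 1 (s k) x is close to b and pi(x) = pi(s k) ratpi 1 (s k) x is close to
    b pi(w). *)
Lemma far_from_band : exists2 eta : R, 0 < eta & \forall k \near \oo, forall x,
  ~ (ypi R x \in `](iypi R w * (b - e)), (iypi R w * (b + e))[) ->
  eta <= `|ratpi R 3 (s k) x - b ^+ 3|.
Proof.
set P := iypi R w; have P0 : 0 < P := hw.
have b2 : 0 < b ^+ 2 by rewrite exprn_gt0.
have b3 : 0 < b ^+ 3 by rewrite exprn_gt0.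
have h0 : 0 < e * b ^+ 2 / 4 by rewrite divr_gt0// mulr_gt0.
(* Since b^2 |Q - b| <= |Q^3 - b^3| for Q = ratpi 1 (s k) x, this value and an error
   at most e b^2 / 4 in [ratpi3_ge] give |Q - b| < e / 2, which leaves half of the
   width e pi(w) of the band for the difference between pi(s k) and pi(w). *)
exists (Num.min (b ^+ 3) (e * b ^+ 2 / 4)); first by rewrite lt_min b3 h0.
near=> k => x xout; rewrite leNgt; apply/negP; rewrite lt_min => /andP[near1 near2].
apply: xout.
have k6 : (6 <= k)%N by near: k; exact: nbhs_infty_ge.
have rk := rank_itail w k.+1; rewrite -/(s k) in rk.
have r9 : 9 / (rank (s k))%:R <= e * b ^+ 2 / 4.
  have : `|(rank (s k))%:R^-1 - 0| <= e * b ^+ 2 / 4 / 9.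
    by near: k; apply: cvgr_distC_le; [exact: cvg_inv_rank_tail|rewrite divr_gt0].
  by rewrite subr0 ger0_norm ?invr_ge0// => h; lra.
have ps : `|ypi R (s k) - P| <= e * P / 4.
  by near: k; apply: cvgr_distC_le; [exact: cvg_ypi_tail|rewrite divr_gt0// mulr_gt0].
have sx : suffix (s k) x.
  apply: contraT => ns; move: near1.
  by rewrite ratpi_nsuffix// sub0r normrN gtr0_norm// ltxx.
rewrite (ypi_suffix R (rank_tail_gt0 w k) sx) -/(s k).
have rk6 : (6 <= rank (s k))%N := leq_trans (leqW k6) rk.
have q3 := ratpi3_ge R rk6 sx.
have [/andP[q0 q1] /andP[a0 a1] _] := ratpi_pow R sx
  (leq_trans (isT : 3 <= 6)%N rk6) (leq_trans (isT : 1 <= 6)%N rk6).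
move: q3 q0 q1 a0 a1 near2 ps r9.
set Q := ratpi R 1 _ _; set T := ratpi R 3 _ _; set p := ypi R _; set r := 9 / _.
move=> q3 q0 q1 a0 a1; rewrite ltr_norml ler_norml => /andP[n1 n2] /andP[p1 p2] r9.
have c1 : - (e * b ^+ 2 / 2) < Q ^+ 3 - b ^+ 3 < e * b ^+ 2 / 2 by apply/andP; split; lra.
have fac : Q ^+ 3 - b ^+ 3 = (Q - b) * (Q ^+ 2 + Q * b + b ^+ 2) by ring.
have S0 : b ^+ 2 <= Q ^+ 2 + Q * b + b ^+ 2.
  by rewrite lerDr addr_ge0 ?sqr_ge0// mulr_ge0// ltW.
move: c1; rewrite fac => /andP[c1 c2].
have Q1 : Q - b < e / 2.
  rewrite ltNge; apply/negP => h.
  have : e / 2 * b ^+ 2 <= (Q - b) * (Q ^+ 2 + Q * b + b ^+ 2).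
    by rewrite ler_pM// ?(ltW b2)// divr_ge0// ltW.
  lra.
have Q2 : b - Q < e / 2.
  rewrite ltNge; apply/negP => h.
  have : e / 2 * b ^+ 2 <= (b - Q) * (Q ^+ 2 + Q * b + b ^+ 2).
    by rewrite ler_pM// ?(ltW b2)// divr_ge0// ltW.
  lra.
have pQ : (p - P) * Q <= e * P / 4 * 1.
  apply: (@le_trans _ _ (e * P / 4 * Q)); first by rewrite ler_wpM2r//; lra.
  by rewrite ler_wpM2l// divr_ge0// mulr_ge0// ltW.
have pQ' : (P - p) * Q <= e * P / 4 * 1.
  apply: (@le_trans _ _ (e * P / 4 * Q)); first by rewrite ler_wpM2r//; lra.
  by rewrite ler_wpM2l// divr_ge0// mulr_ge0// ltW.
have PQ : P * (Q - b) < P * (e / 2) by rewrite ltr_pM2l.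
have PQ' : P * (b - Q) < P * (e / 2) by rewrite ltr_pM2l.
have eP : 0 < e * P by rewrite mulr_gt0.
by rewrite in_itv /=; apply/andP; split; lra.
Unshelve. all: by end_near. Qed.

(** Enough digits 2 in front of s k bring pi down from pi(s k) to about b pi(s k), so
    that pi(V k) tends to b pi(w), see [cvg_ypi_approx]. *)
Lemma approximants : exists V : nat -> seq bool,
  (forall k, suffix (s k) (V k)) /\
  (forall k, `|ratpi R 1 (s k) (V k) - b| <= k.+1%:R^-1).
Proof.
have b01 : 0 < b < 1 by rewrite b0.
have ex k : exists v, suffix (s k) v /\ `|ratpi R 1 (s k) v - b| <= k.+1%:R^-1.
  have [m hm] := ratpi1_approx (rank_tail_gt0 w k) b01.
  exists (nseq m true ++ s k); split; first exact: suffix_suffix.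
  apply: (le_trans hm); have := rank_itail w k.+1; rewrite -/(s k) => rk.
  by rewrite lef_pV2 ?posrE ?ltr0n ?ler_nat//; lia.
have [V VP] := choice ex.
by exists V; split=> k; have [] := VP k.
Qed.

Lemma cvg_Rbar : (fun n : nat => \sum_(v \in Rbar w b n e) mu w b v) @ \oo --> (0 : R).
Proof.
have [V [sV Vb]] := approximants.
have [eta eta0 far] := far_from_band.
have RbarE n : \sum_(v \in Rbar w b n e) mu w b v =
    \sum_(v <- words n | v \in Rbar w b n e) mu w b v.
  by apply: sum_YF => v [].
apply/cvgrPdist_le => d d0.
have de0 : 0 < d * eta ^+ 2 / 2 by rewrite divr_gt0// mulr_gt0// exprn_gt0.
have A0 : (fun k => ((iypi R w * b / ypi R (s k)) ^+ 3 - b ^+ 3) ^+ 2 +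
    54 * (rank (s k))%:R^-1) @ \oo --> (0 : R).
  rewrite -[X in _ --> X]addr0; apply: cvgD; last first.
    by rewrite -(mulr0 54); apply: cvgMr; exact: cvg_inv_rank_tail.
  have c4 : (fun k => iypi R w * b / ypi R (s k)) @ \oo --> b.
    rewrite -[X in _ --> X](mulfK (lt0r_neq0 hw)) (mulrC b).
    by apply: cvgMr; apply: cvgV; [exact: lt0r_neq0|exact: cvg_ypi_tail].
  have c3 : (fun k => (iypi R w * b / ypi R (s k)) ^+ 3 - b ^+ 3) @ \oo --> (0 : R).
    rewrite -(subrr (b ^+ 3)); apply: cvgB; last exact: cvg_cst.
    exact: (cvg_comp _ _ c4 (@exprn_continuous R 3 _)).
  have := cvg_comp _ _ c3 (@exprn_continuous R 2 0).
  by rewrite expr0n.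
have [k [k5 fark Ak]] : exists k, [/\ (5 < k)%N,
    forall x, ~ (ypi R x \in `](iypi R w * (b - e)), (iypi R w * (b + e))[) ->
      eta <= `|ratpi R 3 (s k) x - b ^+ 3| &
    ((iypi R w * b / ypi R (s k)) ^+ 3 - b ^+ 3) ^+ 2 + 54 * (rank (s k))%:R^-1
      <= d * eta ^+ 2 / 2].
  apply: (@filter_ex _ \oo); near=> k; split.
  - by near: k; exact: nbhs_infty_ge.
  - by near: k; exact: far.
  - by near: k; apply: (cvgr_le _ A0).
set C : R := ((rank (s k)).+1 * rank (s k))%:R * dimw R (s k).
near=> n.
have nr : (rank (s k) <= n)%N by near: n; exact: nbhs_infty_ge.
have n0 : (0 < n)%N by near: n; exact: nbhs_infty_gt.
have nC : 3 * C / (d * eta ^+ 2 / 2) <= n%:R by near: n; exact: nbhs_infty_ger.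
have hb : 0 <= b <= 1 by rewrite !ltW.
have farR x : Rbar w b n e x -> eta <= `|ratpi R 3 (s k) x - b ^+ 3|.
  by move=> [xn xR]; apply: fark => xin; apply: xR; split.
have h := @mu_chebyshev R w b V sV Vb (Rbar w b n e) n k eta hb eta0 k5 nr farR.
rewrite -/C -RbarE in h; rewrite sub0r normrN.
have mu0 : 0 <= \sum_(v \in Rbar w b n e) mu w b v.
  rewrite RbarE; apply: sumr_ge0 => x _; exact: (@mu_ge0 R w b V sV Vb).
have e2 : 0 < eta ^+ 2 by rewrite exprn_gt0.
rewrite ger0_norm// -(ler_pM2l e2) (le_trans h)//.
have : 3 * (C / n%:R) <= d * eta ^+ 2 / 2.
  by rewrite mulrA ler_pdivrMr ?ltr0n// [leRHS]mulrC -ler_pdivrMr.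
lra.
Unshelve. all: by end_near. Qed.

Lemma cvg_Rset : (fun n : nat => \sum_(v \in Rset w b n e) mu w b v) @ \oo --> (1 : R).
Proof.
have [V [sV Vb]] := approximants.
rewrite (_ : (fun n => _) = fun n => 1 - \sum_(v \in Rbar w b n e) mu w b v).
  by rewrite -[X in _ --> X]subr0; apply: cvgB; [exact: cvg_cst|exact: cvg_Rbar].
apply/funext => n; apply/esym/eqP; rewrite subr_eq addrC; apply/eqP.
rewrite -(@mu_sum R w b V sV Vb n) !(@sum_YF _ n); [|by move=> v []|by move=> v []].
rewrite (bigID (fun v => v \in Rbar w b n e)) /=; congr (_ + _).
rewrite big_seq_cond [RHS]big_seq_cond; apply: eq_bigl => v.
case vn: (v \in words n) => //=; move/idP: vn; rewrite mem_words => /eqP vn.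
apply/idP/idP => [/negP vB|].
  by rewrite inE; apply: contrapT => vR; apply: vB; rewrite inE.
by rewrite inE => vR; apply/negP; rewrite inE => -[].
Qed.
End Concentration.

Theorem mainTheorem3 (R : realType) (w : nat -> digit) (b e : R)
    (hw : YFplus R w) (hb0 : 0 < b) (hb1 : b < 1) (he : 0 < e) :
  ((fun n : nat => \sum_(v \in Rbar w b n e) mu w b v) @ \oo --> (0 : R)) /\
  ((fun n : nat => \sum_(v \in Rset w b n e) mu w b v) @ \oo --> (1 : R)).
Proof. by split; [exact: cvg_Rbar|exact: cvg_Rset]. Qed.
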